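(* Let $\tilde B=\begin{pmatrix}0&-2&2\\2&0&-2\\-2&2&0\\1&0&0\\0&1&0\\0&0&1\end{pmatrix}$ (the Markov exchange matrix with principal coefficients: 3 mutable and 3 frozen variables). Then the cluster algebra $A_{\mathrm{prin}}$ of $\tilde B$ has no mysterious points, while the upper cluster algebra $U_{\mathrm{prin}}$ of $\tilde B$ has mysterious points; that is, $\mathcal D(\operatorname{Spec}A_{\mathrm{prin}})=\mathcal S(\operatorname{Spec}A_{\mathrm{prin}})$, while $\mathcal S(\operatorname{Spec}U_{\mathrm{prin}})\subsetneq\mathcal D(\operatorname{Spec}U_{\mathrm{prin}})$.
   Context: For an extended exchange matrix $\tilde B=(b_{ij})$ (an $(n+m)\times n$ integer matrix with skew-symmetric top $n\times n$ block), a seed is $(\tilde{\mathbf x},\tilde B)$ with $\tilde{\mathbf x}=(x_1,\dots,x_{n+m})$ freely generating $\mathcal F=\mathbb{C}(x_1,\dots,x_{n+m})$, $x_{n+1},\dots,x_{n+m}$ being frozen; mutation at $k\le n$ performs matrix mutation and replaces $x_k$ by $x_k^{-1}\big(\prod_{b_{ik}>0}x_i^{b_{ik}}+\prod_{b_{ik}<0}x_i^{-b_{ik}}\big)$. The cluster algebra $A$ is the $\mathbb{C}[x_{n+1}^{\pm1},\dots,x_{n+m}^{\pm1}]$-subalgebra of $\mathcal F$ generated by all cluster variables of the set $\Sigma(A)$ of seeds obtained by iterated mutation. The upper cluster algebra is $U=\bigcap_{(\tilde{\mathbf z},\tilde B')\in\Sigma(A)}\mathbb{C}[z_1^{\pm1},\dots,z_{n+m}^{\pm1}]\supseteq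 A$. Put $\mathcal A=\operatorname{Spec}A$, $\mathcal U=\operatorname{Spec}U$. For $t\in\Sigma(A)$ the cluster torus $T(t)$ embeds in both $\mathcal A$ and $\mathcal U$ as the open locus where all variables of $t$ are nonzero; the deep loci are $\mathcal D(\mathcal A)=\mathcal A\setminus\bigcup_tT(t)$ and $\mathcal D(\mathcal U)=\mathcal U\setminus\bigcup_tT(t)$. $\operatorname{Aut}(A)$ is the group of algebra automorphisms of $A$ sending every (mutable or frozen) variable to a nonzero scalar multiple of itself; it acts also on $U$. $\mathcal S(\mathcal A)$ and $\mathcal S(\mathcal U)$ are the sets of points of $\mathcal A$, resp. $\mathcal U$, with nontrivial $\operatorname{Aut}(A)$-stabilizer. Always $\mathcal S\subseteq\mathcal D$; points of $\mathcal D\setminus\mathcal S$ are called mysterious. *)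

(* Defs.v *)
From HB Require Import structures.
From mathcomp Require Import all_boot all_order all_algebra.
From mathcomp Require Import fraction mpoly complex.
From mathcomp Require Import boolp classical_sets reals.

Set Implicit Arguments.
Unset Strict Implicit.
Unset Printing Implicit Defensive.

Import Order.TTheory GRing.Theory Num.Theory.
Local Open Scope classical_set_scope.
Local Open Scope ring_scope.

(* The field K(x_1, ..., x_N), with its structure of K-algebra: MathComp puts
   only a field structure on fraction fields. *)
Definition ratfun (K : fieldType) (N : nat) : Type := {fraction {mpoly K[N]}}.

HB.instance Definition _ (K : fieldType) (N : nat) :=
  GRing.Field.on (ratfun K N).

Section RatfunAlgebra.
Variables (K : fieldType) (N : nat).
Implicit Types (a b : K) (f g : ratfun K N).

Definition ratfunC a : ratfun K N := tofrac (a%:MP_[N]).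

Definition ratfun_scale a f : ratfun K N := ratfunC a * f.

Fact ratfun_scaleA a b f :
  ratfun_scale a (ratfun_scale b f) = ratfun_scale (a * b) f.
Proof. by rewrite /ratfun_scale /ratfunC mpolyCM tofracM mulrA. Qed.

Fact ratfun_scale1 : left_id 1 ratfun_scale.
Proof. by move=> f; rewrite /ratfun_scale /ratfunC mpolyC1 tofrac1 mul1r. Qed.

Fact ratfun_scaleDr : right_distributive ratfun_scale +%R.
Proof. by move=> a f g; rewrite /ratfun_scale mulrDr. Qed.

Fact ratfun_scaleDl f : {morph ratfun_scale^~ f : a b / a + b}.
Proof.
by move=> a b; rewrite /ratfun_scale /ratfunC mpolyCD tofracD mulrDl.
Qed.

HB.instance Definition _ := GRing.Zmodule_isLmodule.Build K (ratfun K N)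
  ratfun_scaleA ratfun_scale1 ratfun_scaleDr ratfun_scaleDl.

Fact ratfun_scaleAl a f g : a *: (f * g) = (a *: f) * g.
Proof. exact: mulrA. Qed.

HB.instance Definition _ :=
  GRing.Lmodule_isLalgebra.Build K (ratfun K N) ratfun_scaleAl.

Fact ratfun_scaleAr a f g : a *: (f * g) = f * (a *: g).
Proof. exact: mulrCA. Qed.

HB.instance Definition _ :=
  GRing.Lalgebra_isAlgebra.Build K (ratfun K N) ratfun_scaleAr.

End RatfunAlgebra.

Section Subalgebras.
Variables (K : fieldType) (F : algType K).

Inductive subalg_gen (G : set F) : set F :=
| subalg_gen_in x of G x : subalg_gen G x
| subalg_gen1 : subalg_gen G 1
| subalg_genZD a x y of subalg_gen G x & subalg_gen G y :
    subalg_gen G (a *: x + y)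
| subalg_genM x y of subalg_gen G x & subalg_gen G y : subalg_gen G (x * y).

Record subalg_sort (S : subalgClosed F) : Type :=
  SubalgElt { subalg_val : F; _ : subalg_val \in S }.

HB.instance Definition _ S := [isSub for @subalg_val S].
HB.instance Definition _ S := [Choice of subalg_sort S by <:].
HB.instance Definition _ S := [SubChoice_isSubAlgebra of subalg_sort S by <:].

(* The closed points of Spec S, as K-points: for K the complex numbers and S of
   countable dimension, such as the algebras below, every maximal ideal of S has
   residue field K, even when S is not finitely generated. *)
Definition spec_points (S : subalgClosed F) : Type :=
  {lrmorphism subalg_sort S -> K^o}.

End Subalgebras.

Section ClusterAlgebras.
Variables (K : fieldType) (n m : nat).

Notation F := (ratfun K (n + m)).

(* Indices lshift m k (k < n) are the mutable ones, rshift n j (j < m) the frozen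
   ones. That the variables freely generate F is preserved by mutation, hence
   holds for all the seeds considered below. *)
Record seed : Type := Seed {
  seed_var : 'I_(n + m) -> F;
  seed_mx : 'M[int]_(n + m, n)
}.

Definition mutate_mx (B : 'M[int]_(n + m, n)) (k : 'I_n) : 'M[int]_(n + m, n) :=
  \matrix_(i, j)
    if (i == lshift m k) || (j == k) then - B i j
    else B i j + Num.sg (B i k) * Num.max 0 (B i k * B (lshift m k) j).

Definition mutate (t : seed) (k : 'I_n) : seed :=
  let x := seed_var t in
  let B := seed_mx t in
  Seed
    (fun i => if i == lshift m k then
                (x i)^-1 * (\prod_(l | 0 < B l k) x l ^+ `|B l k|%N
                            + \prod_(l | B l k < 0) x l ^+ `|B l k|%N)
              else x i)
    (mutate_mx B k).

Definition initial_seed (B : 'M[int]_(n + m, n)) : seed :=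
  Seed (fun i => tofrac 'X_i) B.

Variable B : 'M[int]_(n + m, n).

Definition seeds : set seed :=
  [set t | exists ks : seq 'I_n, t = foldl mutate (initial_seed B) ks].

Definition cluster_generators : set F :=
  [set z | exists2 t, seeds t & exists i, z = seed_var t i] `|`
  [set z | exists j : 'I_m, z = (seed_var (initial_seed B) (rshift n j))^-1].

Definition cluster_algebra : {pred F} :=
  [pred z | `[< subalg_gen cluster_generators z >]].

Definition laurent_ring (t : seed) : set F :=
  subalg_gen
    [set z | exists i, z = seed_var t i \/ z = (seed_var t i)^-1].

Definition upper_cluster_algebra : {pred F} :=
  [pred z | `[< forall t, seeds t -> laurent_ring t z >]].

Fact cluster_algebra_closed : subalg_closed cluster_algebra.
Proof.
split.
- by apply/asboolP; exact: subalg_gen1.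
- by move=> a x y /asboolP hx /asboolP hy; apply/asboolP; exact: subalg_genZD.
- by move=> x y /asboolP hx /asboolP hy; apply/asboolP; exact: subalg_genM.
Qed.

HB.instance Definition _ :=
  GRing.isSubalgClosed.Build K F cluster_algebra cluster_algebra_closed.

Fact upper_cluster_algebra_closed : subalg_closed upper_cluster_algebra.
Proof.
split.
- by apply/asboolP => t _; exact: subalg_gen1.
- move=> a x y /asboolP hx /asboolP hy; apply/asboolP => t ht.
  by apply: subalg_genZD; [exact: hx | exact: hy].
- move=> x y /asboolP hx /asboolP hy; apply/asboolP => t ht.
  by apply: subalg_genM; [exact: hx | exact: hy].
Qed.

HB.instance Definition _ :=
  GRing.isSubalgClosed.Build K F upper_cluster_algebra
    upper_cluster_algebra_closed.

Notation A := (subalg_sort cluster_algebra).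

Definition cluster_aut : set {lrmorphism A -> A} :=
  [set phi : {lrmorphism A -> A} | bijective phi /\
     forall t i (a : A), seeds t -> \val a = seed_var t i ->
       exists2 c : K, c != 0 & phi a = c *: a].

(* Below, S is the cluster algebra or the upper cluster algebra of B. *)
Section Loci.
Variable S : subalgClosed F.

(* Both algebras contain all variables of all seeds (for the upper one, by the
   Laurent phenomenon), so the element u exists and is unique. *)
Definition cluster_torus (t : seed) : set (spec_points S) :=
  [set p : spec_points S | forall i, exists2 u : subalg_sort S,
             \val u = seed_var t i & p u != 0].

Definition deep_locus : set (spec_points S) :=
  ~` \bigcup_(t in seeds) cluster_torus t.

(* The action of an automorphism of A on S, where A is contained in S and S in
   the fraction field of A: psi is the unique endomorphism of S extending phi
   (so psi = phi if S = A). *)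
Definition extends_aut (phi : {lrmorphism A -> A})
    (psi : {lrmorphism subalg_sort S -> subalg_sort S}) : Prop :=
  forall (a : A) (u : subalg_sort S),
    \val a = \val u -> \val (phi a) = \val (psi u).

Definition stabilized_locus : set (spec_points S) :=
  [set p : spec_points S | exists phi : {lrmorphism A -> A}, [/\
     cluster_aut phi, exists a, phi a != a &
     exists2 psi : {lrmorphism subalg_sort S -> subalg_sort S},
       extends_aut phi psi & forall u, p (psi u) = p u]].

End Loci.

End ClusterAlgebras.

Arguments seeds K {n m} B _.
Arguments cluster_algebra K {n m} B.
Arguments upper_cluster_algebra K {n m} B.
Arguments deep_locus {K n m} B S _.
Arguments stabilized_locus {K n m} B S _.

Definition markov_prin : 'M[int]_(3 + 3, 3) :=
  \matrix_(i, j)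
    nth 0 (nth [::] [:: [::  0; -2;  2];
                        [::  2;  0; -2];
                        [:: -2;  2;  0];
                        [::  1;  0;  0];
                        [::  0;  1;  0];
                        [::  0;  0;  1]] i) j.

(* Main.v *)
(* Every seed carries a Markov quiver, so each exchange relation has the form
   x_i x_i' = P x_j^2 + Q x_k^2 with P, Q units.

   A_prin.  At a deep point these relations force the same mutable positions to
   vanish in all seeds: either a single position, or all three.  Changing the sign
   of the variables at those positions is an automorphism of A fixing the point.
   Conversely an automorphism fixing a point of a cluster torus fixes the variables
   of that seed, hence everything.

   U_prin.  Put L = y_1 y_2 y_3.  Besides the cluster variables U contains
     X_i = (y_k x_i^2 + y_j y_k x_k^2 + x_j^2) / (x_j x_k)   and
     W_i = ((1 - L)^2 + y_i X_i^2) / x_i                      (i, j, k cyclic):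
   the same formulas in a mutated seed give elements generating the same algebra
   over the frozen variables.  The mysterious point is the origin of the plane
     x = (s - i r, s, r),  y = (1, 1, -(1 + r)).
   On it the variables of the initial seed and of its three neighbours are pairwise
   coprime up to units, so elements of U have no pole at s = r = 0.  There all
   cluster variables vanish, so the point is deep; but the y_i, X_1, X_2 and W_1
   do not vanish, and their weights generate the character group of Aut(A). *)

From HB Require Import structures.
Require Import Defs.
From mathcomp Require Import all_boot all_order all_algebra.
From mathcomp Require Import fraction mpoly complex.
From mathcomp Require Import boolp classical_sets reals.
From mathcomp Require Import ring zify.

Set Implicit Arguments.
Unset Strict Implicit.
Unset Printing Implicit Defensive.

Import Order.TTheory GRing.Theory Num.Theory.
Local Open Scope classical_set_scope.
Local Open Scope ring_scope.
(** * Evaluating fractions along a ring morphism *)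

Lemma tofrac_den (R0 : idomainType) (x : {fraction R0}) :
  exists n d, d != 0 /\ x * tofrac d = tofrac n.
Proof.
elim/quotW: x => r; exists (frac r).1, (frac r).2.
split; first exact: denom_ratioP.
rewrite !piE /FracField.mulf; apply/eqP.
rewrite FracField.equivf_def !numden_Ratio ?mulf_neq0 ?oner_neq0 ?denom_ratioP //.
by apply/eqP; ring.
Qed.

Section EvalFrac.
Variables (R0 : idomainType) (E : fieldType) (f : {rmorphism R0 -> E}).
Implicit Types (x y : {fraction R0}).

(** A relation, since the presentation [n / d] with [f d != 0] is not canonical: over a general
    domain fractions have no reduced form. *)
Definition evalfrac_graph x : set E :=
  [set e | exists n d, [/\ f d != 0, x * tofrac d = tofrac n & e * f d = f n]].

Definition evalfrac x : E := xget 0 (evalfrac_graph x).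

(* The domain of evalfrac is the local ring at the kernel of f; outside of it
   evalfrac takes the junk value 0. *)
Definition frac_local x : Prop := exists e, evalfrac_graph x e.

Lemma evalfrac_graph_inj x e e' :
  evalfrac_graph x e -> evalfrac_graph x e' -> e = e'.
Proof.
move=> [n [d [d0 xd ed]]] [n' [d' [d'0 xd' ed']]].
have H : n * d' = n' * d.
  apply/eqP; rewrite -tofrac_eq !tofracM -xd -xd'; apply/eqP; ring.
apply: (mulIf (mulf_neq0 d0 d'0)).
by rewrite mulrA ed [f d * _]mulrC mulrA ed' -!rmorphM H.
Qed.

Lemma evalfracP x e : evalfrac_graph x e -> evalfrac x = e.
Proof.
move=> h; rewrite /evalfrac; case: xgetP => [e' _ h'|/(_ e) //].
exact: evalfrac_graph_inj h' h.
Qed.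

Lemma evalfrac_graphE x : frac_local x -> evalfrac_graph x (evalfrac x).
Proof. by move=> [e h]; rewrite (evalfracP h). Qed.

Lemma evalfrac_graph_tofrac n : evalfrac_graph (tofrac n) (f n).
Proof. by exists n, 1; rewrite rmorph1 tofrac1 !mulr1 oner_neq0. Qed.

Lemma evalfrac_graphD x y a b : evalfrac_graph x a -> evalfrac_graph y b ->
  evalfrac_graph (x + y) (a + b).
Proof.
move=> [n [d [d0 xd ed]]] [n' [d' [d'0 xd' ed']]].
exists (n * d' + n' * d), (d * d'); split.
- by rewrite rmorphM mulf_neq0.
- by rewrite tofracD !tofracM -xd -xd'; ring.
- by rewrite rmorphD !rmorphM -ed -ed'; ring.
Qed.

Lemma evalfrac_graphM x y a b : evalfrac_graph x a -> evalfrac_graph y b ->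
  evalfrac_graph (x * y) (a * b).
Proof.
move=> [n [d [d0 xd ed]]] [n' [d' [d'0 xd' ed']]].
exists (n * n'), (d * d'); split.
- by rewrite rmorphM mulf_neq0.
- by rewrite !tofracM -xd -xd'; ring.
- by rewrite !rmorphM -ed -ed'; ring.
Qed.

Lemma evalfrac_graphV x a : a != 0 -> evalfrac_graph x a ->
  evalfrac_graph x^-1 a^-1.
Proof.
move=> a0 [n [d [d0 xd ed]]].
have n0 : f n != 0 by rewrite -ed mulf_neq0.
have tn0 : tofrac n != 0 :> {fraction R0}.
  by rewrite tofrac_eq0; apply: contraNneq n0 => ->; rewrite rmorph0.
have x0 : x != 0 by apply: contraNneq tn0 => x0; rewrite -xd x0 mul0r.
by exists d, n; split=> //; [rewrite -xd mulKf | rewrite -ed mulKf].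
Qed.

Lemma frac_local_tofrac n : frac_local (tofrac n).
Proof. by exists (f n); exact: evalfrac_graph_tofrac. Qed.

Lemma frac_localD x y : frac_local x -> frac_local y -> frac_local (x + y).
Proof. by move=> [a ha] [b hb]; exists (a + b); exact: evalfrac_graphD. Qed.

Lemma frac_localM x y : frac_local x -> frac_local y -> frac_local (x * y).
Proof. by move=> [a ha] [b hb]; exists (a * b); exact: evalfrac_graphM. Qed.

Lemma frac_localV x : frac_local x -> evalfrac x != 0 -> frac_local x^-1.
Proof.
move=> [a ha]; rewrite (evalfracP ha) => a0.
by exists a^-1; exact: evalfrac_graphV.
Qed.

Lemma evalfrac_tofrac n : evalfrac (tofrac n) = f n.
Proof. exact/evalfracP/evalfrac_graph_tofrac. Qed.

Lemma evalfracD x y : frac_local x -> frac_local y ->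
  evalfrac (x + y) = evalfrac x + evalfrac y.
Proof.
by move=> hx hy; apply/evalfracP/evalfrac_graphD; exact: evalfrac_graphE.
Qed.

Lemma evalfracM x y : frac_local x -> frac_local y ->
  evalfrac (x * y) = evalfrac x * evalfrac y.
Proof.
by move=> hx hy; apply/evalfracP/evalfrac_graphM; exact: evalfrac_graphE.
Qed.

Lemma evalfracV x : frac_local x -> evalfrac x != 0 ->
  evalfrac x^-1 = (evalfrac x)^-1.
Proof.
by move=> hx x0; apply/evalfracP/evalfrac_graphV => //; exact: evalfrac_graphE.
Qed.

(** Serves to extend an injective morphism from a domain to its whole fraction field. *)
Lemma frac_local_inj x : injective f -> frac_local x.
Proof.
move=> f_inj; have [n [d [d0 xd]]] := tofrac_den x.
have fd0 : f d != 0 by rewrite -(rmorph0 f) (inj_eq f_inj).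
by exists (f n / f d), n, d; rewrite divfK.
Qed.

End EvalFrac.
(** * Mutation identities *)

Section MarkovIdentities.
Variable F : fieldType.

Definition markov_X (Yj Yk zi zj zk : F) : F :=
  (Yk * zi ^+ 2 + Yj * Yk * zk ^+ 2 + zj ^+ 2) / (zj * zk).

Definition markov_W (Yi Yj Yk zi zj zk : F) : F :=
  ((1 - Yi * Yj * Yk) ^+ 2 + Yi * markov_X Yj Yk zi zj zk ^+ 2) / zi.

Definition markov_gen_in (S : {pred F}) (Yi Yj Yk zi zj zk : F) : Prop :=
  [/\ zi \in S, markov_X Yj Yk zi zj zk \in S & markov_W Yi Yj Yk zi zj zk \in S].

Definition markov_gens_in (S : {pred F}) (Yi Yj Yk zi zj zk : F) : Prop :=
  [/\ markov_gen_in S Yi Yj Yk zi zj zk, markov_gen_in S Yj Yk Yi zj zk zi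
    & markov_gen_in S Yk Yi Yj zk zi zj].

Lemma markov_gens_in_rot S Yi Yj Yk zi zj zk :
  markov_gens_in S Yi Yj Yk zi zj zk <-> markov_gens_in S Yj Yk Yi zj zk zi.
Proof. by split; case. Qed.

Lemma markov_gen_in_laurent (S : subringClosed F) Yi Yj Yk zi zj zk :
  Yi \in S -> Yj \in S -> Yk \in S -> zi \in S -> zi^-1 \in S ->
  zj \in S -> zj^-1 \in S -> zk \in S -> zk^-1 \in S ->
  markov_gen_in S Yi Yj Yk zi zj zk.
Proof.
move=> hYi hYj hYk hi hiV hj hjV hk hkV.
have hX : markov_X Yj Yk zi zj zk \in S.
  by rewrite /markov_X invfM !(rpredM, rpredD, rpredX).
split=> //; rewrite /markov_W rpredM // rpredD //; last by rewrite rpredM // rpredX.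
by rewrite rpredX // rpredB ?rpred1 // rpredM // rpredM.
Qed.

Section Mutation.
Variables (P Q Yj Yk zi zj zk : F).
Hypotheses (P0 : P != 0) (Q0 : Q != 0) (Yj0 : Yj != 0) (Yk0 : Yk != 0).
Hypotheses (zi0 : zi != 0) (zj0 : zj != 0) (zk0 : zk != 0).

Let zi' := (P * zj ^+ 2 + Q * zk ^+ 2) / zi.
Hypothesis zi'0 : zi' != 0.

(** [P] and [Q] stand for the two frozen monomials of the exchange at the first index; the primed
    letters follow the rule by which the ratios [coefY] mutate. *)
Let Yi := P / Q.
Let Yi' := Yi^-1.
Let Yj' := Yj / Q ^+ 2.
Let Yk' := Yk * P ^+ 2.

Let Xi := markov_X Yj Yk zi zj zk.
Let Xj := markov_X Yk Yi zj zk zi.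
Let Xk := markov_X Yi Yj zk zi zj.
Let Wi := markov_W Yi Yj Yk zi zj zk.
Let Wj := markov_W Yj Yk Yi zj zk zi.
Let Wk := markov_W Yk Yi Yj zk zi zj.

(* The mutated seed has the opposite orientation, so that its second and third
   indices are exchanged. *)
Let Xi' := markov_X Yk' Yj' zi' zk zj.
Let Xj' := markov_X Yi' Yk' zj zi' zk.
Let Xk' := markov_X Yj' Yi' zk zj zi'.

Let b0 : P * zj ^+ 2 + Q * zk ^+ 2 != 0.
Proof. by apply: contraNneq zi'0 => h; rewrite /zi' h mul0r. Qed.

Lemma markov_mutX_second : Xj' = Q * Xj.
Proof.
rewrite /Xj' /Xj /markov_X /Yi' /Yk' /Yi /zi'; field.
by rewrite P0 Q0 zi0 zk0 b0.
Qed.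

Lemma markov_mutX_third : Xk' = Xk / P.
Proof.
rewrite /Xk' /Xk /markov_X /Yi' /Yj' /Yi /zi'; field.
by rewrite P0 Q0 zi0 zj0 b0.
Qed.

Lemma markov_mutX_first : Xi' = Xj * Xk - Yi * Xi.
Proof.
rewrite /Xi' /Xi /Xj /Xk /markov_X /Yj' /Yk' /Yi /zi'; field.
by rewrite Q0 zi0 zj0 zk0.
Qed.

Lemma markov_mutz : zi' = Q * (Xj * zk - Yi * Yk * zi).
Proof.
rewrite /zi' /Xj /markov_X /Yi; field.
by rewrite Q0 zi0 zk0.
Qed.

(** The [W] obey a linear recursion with multiplier [Xj], like the one of [markov_mutz] for the
    cluster variables. *)
Lemma markov_mutW_first :
  markov_W Yi' Yk' Yj' zi' zk zj = (Xj * Wk - Wi) / (Q * Yi * Yk).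
Proof.
rewrite /Wk /Wi /Xj /markov_W /markov_X /Yi' /Yj' /Yk' /Yi /zi'; field.
by rewrite ?P0 ?Q0 ?Yk0 ?zi0 ?zj0 ?zk0 ?b0.
Qed.

Lemma markov_mutW_second : markov_W Yj' Yi' Yk' zj zi' zk = Wj.
Proof.
rewrite /Wj /markov_W /markov_X /Yi' /Yj' /Yk' /Yi /zi'; field.
by rewrite ?P0 ?Q0 ?Yk0 ?zi0 ?zj0 ?zk0 ?b0.
Qed.

Lemma markov_mutW_third : markov_W Yk' Yj' Yi' zk zj zi' = Wk.
Proof.
rewrite /Wk /markov_W /markov_X /Yi' /Yj' /Yk' /Yi /zi'; field.
by rewrite ?P0 ?Q0 ?Yk0 ?zi0 ?zj0 ?zk0 ?b0.
Qed.

(** Each mutation identity gives a new element as a polynomial in old ones, up to units. The element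
    being replaced enters linearly with a unit coefficient, so the identity can also be solved for
    it. *)
Lemma markov_gens_in_mutate (S : subringClosed F) :
  P \in S -> P^-1 \in S -> Q \in S -> Q^-1 \in S -> Yk \in S -> Yk^-1 \in S ->
  markov_gens_in S Yi Yj Yk zi zj zk <-> markov_gens_in S Yi' Yk' Yj' zi' zk zj.
Proof.
move=> P_in PV_in Q_in QV_in Y_in YV_in.
have PQ_in : P / Q \in S by rewrite rpredM.
have PQV_in : (P / Q)^-1 \in S by rewrite invfM invrK rpredM.
have PQ0 : P / Q != 0 by rewrite mulf_neq0 ?invr_eq0.
rewrite /markov_gens_in /markov_gen_in -/Xi -/Xj -/Xk -/Wi -/Wj -/Wk -/Xi' -/Xj' -/Xk'.
rewrite markov_mutX_second markov_mutX_third markov_mutW_first markov_mutW_second.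
rewrite markov_mutW_third; split.
- move=> [[hzi hXi hWi] [hzj hXj hWj] [hzk hXk hWk]].
  have V_in : (Q * Yi * Yk)^-1 \in S by rewrite invfM rpredM // invfM rpredM.
  rewrite markov_mutX_first markov_mutz -/Yi.
  have hYz : Yi * Yk * zi \in S by rewrite rpredM ?rpredM.
  have hXX : Xj * Xk \in S by rewrite rpredM.
  have hYX : Yi * Xi \in S by rewrite rpredM.
  have hXz : Xj * zk \in S by rewrite rpredM.
  have hXW : Xj * Wk \in S by rewrite rpredM.
  have hd : Xj * zk - Yi * Yk * zi \in S by rewrite rpredB.
  have hw : Xj * Wk - Wi \in S by rewrite rpredB.
  by split; split=> //; by [rewrite rpredM | rewrite rpredB].
- move=> [[hzi' hXi' hWi'] [hzk hXk' hWk] [hzj hXj' hWj]].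
  (* [Xj] and [Xk] are unit multiples of elements of the mutated seed; they come first because the
     recovery of [Xi], [zi] and [Wi] uses them. *)
  have hXj : Xj \in S by rewrite -(mulKf Q0 Xj) rpredM.
  have hXk : Xk \in S by rewrite -(divfK P0 Xk) rpredM.
  have hXi : Xi \in S.
    have -> : Xi = Yi^-1 * (Xj * Xk - Xi') by rewrite markov_mutX_first subKr mulKf.
    by rewrite rpredM // rpredB // rpredM.
  have hzi : zi \in S.
    have -> : zi = Yi^-1 * Yk^-1 * (Xj * zk - Q^-1 * zi').
      have YY0 : Yi * Yk != 0 by rewrite mulf_neq0.
      by rewrite -invfM markov_mutz mulKf // subKr mulKf.
    by rewrite rpredM ?rpredM // rpredB // rpredM.
  have hWi : Wi \in S.
    have -> : Wi = Xj * Wk - (Xj * Wk - Wi) / (Q * Yi * Yk) * (Q * Yi * Yk).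
      have d0 : Q * Yi * Yk != 0 by rewrite mulf_neq0 // mulf_neq0.
      by rewrite divfK // subKr.
    have hXW : Xj * Wk \in S by rewrite rpredM.
    have hY : Q * Yi * Yk \in S by rewrite rpredM ?rpredM.
    by rewrite rpredB // rpredM.
  by [].
Qed.

End Mutation.

End MarkovIdentities.
(** * Seeds of the Markov quiver *)

Lemma mem_triple (i j k l : 'I_3) : uniq [:: i; j; k] -> [\/ l = i, l = j | l = k].
Proof.
move=> u.
case: (eqVneq l i) => [->|li]; first by constructor 1.
case: (eqVneq l j) => [->|lj]; first by constructor 2.
case: (eqVneq l k) => [->|lk]; first by constructor 3.
(* Pigeonhole: four distinct elements do not fit into ['I_3]. *)
have u4 : uniq [:: l; i; j; k] by rewrite cons_uniq u !inE !negb_or li lj lk.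
have := @uniq_leq_size _ _ (enum 'I_3) u4 (fun x _ => mem_enum 'I_3 x).
by rewrite size_enum_ord.
Qed.

Lemma big_triple (R : comPzRingType) (G : 'I_3 -> R) (i j k : 'I_3) : uniq [:: i; j; k] ->
  \prod_l G l = G i * G j * G k.
Proof.
move=> u; have p : perm_eq (index_enum 'I_3) [:: i; j; k].
  apply: uniq_perm => // [|l]; first exact: index_enum_uniq.
  rewrite mem_index_enum !inE.
  by have [->|->|->] := mem_triple l u; rewrite eqxx ?orbT.
by rewrite (perm_big _ p) !big_cons big_nil /= mulrA mulr1.
Qed.

Section MarkovSeeds.
Variable K : numFieldType.

Notation F := (ratfun K (3 + 3)).
Notation seed := (seed K 3 3).
Notation mutx t i := (seed_var t (lshift 3 i)).
Implicit Types (t : seed) (B : 'M[int]_(3 + 3, 3)) (i j k l : 'I_3).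

Definition frozen l : F := tofrac 'X_(rshift 3 l).

Definition posY B k : F :=
  \prod_(l | 0 < B (rshift 3 l) k) frozen l ^+ `|B (rshift 3 l) k|%N.
Definition negY B k : F :=
  \prod_(l | B (rshift 3 l) k < 0) frozen l ^+ `|B (rshift 3 l) k|%N.
Definition coefY B k : F := posY B k / negY B k.

Definition markov_col B i j k : Prop :=
  [/\ B (lshift 3 i) i = 0, B (lshift 3 j) i = 2 & B (lshift 3 k) i = -2].

(** The triple lists the indices along the cyclic orientation of the quiver. Mutation reverses the
    orientation, so the triple has to vary with the seed. *)
Definition markov_oriented B i j k : Prop :=
  [/\ uniq [:: i; j; k], markov_col B i j k, markov_col B j k i
    & markov_col B k i j].

(* Only used to see that cluster variables are nonzero rational functions. *)
Definition positive_at_ones (z : F) : Prop :=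
  frac_local (meval (fun=> 1) : {rmorphism {mpoly K[3 + 3]} -> K}) z /\
  0 < evalfrac (meval (fun=> 1) : {rmorphism {mpoly K[3 + 3]} -> K}) z.

Definition markov_seed t i j k : Prop :=
  [/\ markov_oriented (seed_mx t) i j k,
      forall l, seed_var t (rshift 3 l) = frozen l
    & forall a, positive_at_ones (seed_var t a)].

Lemma positive_at_onesD z z' : positive_at_ones z -> positive_at_ones z' ->
  positive_at_ones (z + z').
Proof.
move=> [lz pz] [lz' pz']; split; first exact: frac_localD.
by rewrite evalfracD // addr_gt0.
Qed.

Lemma positive_at_onesM z z' : positive_at_ones z -> positive_at_ones z' ->
  positive_at_ones (z * z').
Proof.
move=> [lz pz] [lz' pz']; split; first exact: frac_localM.
by rewrite evalfracM // mulr_gt0.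
Qed.

Lemma positive_at_onesV z : positive_at_ones z -> positive_at_ones z^-1.
Proof.
move=> [lz pz]; have z0 := lt0r_neq0 pz; split; first exact: frac_localV.
by rewrite evalfracV // invr_gt0.
Qed.

Lemma positive_at_ones_var a : positive_at_ones (tofrac 'X_a : F).
Proof.
split; first exact: frac_local_tofrac.
by rewrite evalfrac_tofrac /= mevalXU ltr01.
Qed.

Lemma positive_at_ones1 : positive_at_ones 1.
Proof.
rewrite -tofrac1; split; first exact: frac_local_tofrac.
by rewrite evalfrac_tofrac rmorph1 ltr01.
Qed.

Lemma positive_at_onesX z n : positive_at_ones z -> positive_at_ones (z ^+ n).
Proof.
move=> pz; elim: n => [|n IH]; first by rewrite expr0; exact: positive_at_ones1.
by rewrite exprS; exact: positive_at_onesM.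
Qed.

Lemma positive_at_ones_neq0 z : positive_at_ones z -> z != 0.
Proof.
move=> [lz]; apply: contraTneq => ->.
by rewrite -tofrac0 evalfrac_tofrac rmorph0 ltxx.
Qed.

Lemma positive_at_ones_posY B k : positive_at_ones (posY B k).
Proof.
apply: (big_ind positive_at_ones); [exact: positive_at_ones1
  | exact: positive_at_onesM
  | move=> l _; exact/positive_at_onesX/positive_at_ones_var].
Qed.

Lemma positive_at_ones_negY B k : positive_at_ones (negY B k).
Proof.
apply: (big_ind positive_at_ones); [exact: positive_at_ones1
  | exact: positive_at_onesM
  | move=> l _; exact/positive_at_onesX/positive_at_ones_var].
Qed.

Lemma frozen_neq0 l : frozen l != 0.
Proof. exact/positive_at_ones_neq0/positive_at_ones_var. Qed.

Lemma posY_neq0 B k : posY B k != 0.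
Proof. exact/positive_at_ones_neq0/positive_at_ones_posY. Qed.

Lemma negY_neq0 B k : negY B k != 0.
Proof. exact/positive_at_ones_neq0/positive_at_ones_negY. Qed.

Lemma coefY_neq0 B k : coefY B k != 0.
Proof. by rewrite mulf_neq0 ?invr_eq0 ?posY_neq0 ?negY_neq0. Qed.

Lemma coefYE B k : coefY B k = \prod_l frozen l ^ B (rshift 3 l) k.
Proof.
rewrite /coefY /posY /negY -prodfV [X in X * _]big_mkcond [X in _ * X]big_mkcond.
rewrite -big_split /=; apply: eq_bigr => l _.
case: (B _ _) => [[|n]|n] /=; rewrite ?mulr1 ?mul1r //.
Qed.

Lemma oriented_rot B i j k : markov_oriented B i j k -> markov_oriented B j k i.
Proof. by move=> [u ci cj ck]; split=> //; rewrite (rot_uniq 1 [:: i; j; k]). Qed.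

(** The entries between [j] and [k] are [2] and [-2], and mutation shifts each by [4] towards the
    opposite sign. With the sign change in row and column [i], the whole quiver is reversed. *)
Lemma oriented_mutate B i j k :
  markov_oriented B i j k -> markov_oriented (mutate_mx B i) i k j.
Proof.
move=> [u [ii ji ki] [jj kj ij] [kk ik jk]].
have /and3P[] : [&& i != j, i != k & j != k].
  by move: u; rewrite /= !inE negb_or andbT => /andP[/andP[-> ->] ->].
move=> nij nik njk; split.
- by rewrite /= !inE negb_or nik nij eq_sym njk.
- by split; rewrite mxE eqxx ?orbT ?ii ?ki ?ji ?oppr0 ?opprK.
- split; rewrite mxE !eq_lshift ?eqxx ?[k == i]eq_sym ?[j == i]eq_sym
    ?[k == j]eq_sym ?(negbTE nij) ?(negbTE nik) ?(negbTE njk) /=;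
  by rewrite ?kk ?jk ?ik ?ki ?ji ?oppr0 //.
- split; rewrite mxE !eq_lshift ?eqxx ?[k == i]eq_sym ?[j == i]eq_sym
    ?[k == j]eq_sym ?(negbTE nij) ?(negbTE nik) ?(negbTE njk) /=;
  by rewrite ?jj ?kj ?ij ?ji ?ki ?oppr0 //.
Qed.

Lemma mutate_mx_frozen B i j l : i != j ->
  mutate_mx B i (rshift 3 l) j = B (rshift 3 l) j +
    Num.sg (B (rshift 3 l) i) * Num.max 0 (B (rshift 3 l) i * B (lshift 3 i) j).
Proof. by move=> nij; rewrite mxE eq_rlshift eq_sym (negbTE nij). Qed.

Lemma coefY_mutate_self B i : coefY (mutate_mx B i) i = (coefY B i)^-1.
Proof.
rewrite !coefYE -prodfV; apply: eq_bigr => l _.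
by rewrite mxE eqxx orbT invr_expz.
Qed.

(** For a frozen entry [c] in column [i], the mutation term is [2 c] if [c < 0] and [0] otherwise;
    the resulting powers multiply to the inverse square of [negY]. *)
Lemma coefY_mutate_neg B i j : i != j -> B (lshift 3 i) j = -2 ->
  coefY (mutate_mx B i) j = coefY B j / negY B i ^+ 2.
Proof.
move=> nij bij; rewrite !coefYE /negY [X in _ / X ^+ 2]big_mkcond /= -prodrXl -prodfV.
rewrite -big_split /=; apply: eq_bigr => l _.
rewrite mutate_mx_frozen // bij; set c := B _ i; set d := B _ j.
case: ltrP => c0.
- have -> : Num.sg c * Num.max 0 (c * -2) = - (`|c|%N * 2)%N%:Z.
    by rewrite ltr0_sg // max_r; lia.
  by rewrite expfzDr ?frozen_neq0 // -exprM exprnN.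
- have -> : Num.sg c * Num.max 0 (c * -2) = 0 by rewrite max_l ?mulr0 //; lia.
  by rewrite addr0 expr1n invr1 mulr1.
Qed.

Lemma coefY_mutate_pos B i k : i != k -> B (lshift 3 i) k = 2 ->
  coefY (mutate_mx B i) k = coefY B k * posY B i ^+ 2.
Proof.
move=> nik bik; rewrite !coefYE /posY [X in _ * X ^+ 2]big_mkcond /= -prodrXl.
rewrite -big_split /=; apply: eq_bigr => l _.
rewrite mutate_mx_frozen // bik; set c := B _ i; set d := B _ k.
case: ltrP => c0.
- have -> : Num.sg c * Num.max 0 (c * 2) = (`|c|%N * 2)%N%:Z.
    by rewrite gtr0_sg // max_r; lia.
  by rewrite expfzDr ?frozen_neq0 // -exprM.
- have -> : Num.sg c * Num.max 0 (c * 2) = 0 by rewrite max_l ?mulr0 //; lia.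
  by rewrite addr0 expr1n mulr1.
Qed.

Lemma mutate_var_neq t k a : a != lshift 3 k ->
  seed_var (mutate t k) a = seed_var t a.
Proof. by move=> /negbTE ak /=; rewrite ak. Qed.

Lemma mutate_var_self t i j k : markov_oriented (seed_mx t) i j k ->
  (forall l, seed_var t (rshift 3 l) = frozen l) ->
  mutx (mutate t i) i =
    (posY (seed_mx t) i * mutx t j ^+ 2 + negY (seed_mx t) i * mutx t k ^+ 2) /
      mutx t i.
Proof.
move=> [u [ii ji ki] _ _] fr /=; rewrite eqxx mulrC; congr (_ / _); congr (_ + _).
- rewrite big_mkcond big_split_ord /= (big_triple _ u) ii ji ki ltxx /= mul1r mulr1.
  rewrite mulrC; congr (_ * _); rewrite -big_mkcond; apply: eq_bigr => l _.
  by rewrite fr.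
- rewrite big_mkcond big_split_ord /= (big_triple _ u) ii ji ki ltxx /= !mul1r.
  rewrite mulrC; congr (_ * _); rewrite -big_mkcond; apply: eq_bigr => l _.
  by rewrite fr.
Qed.

Lemma markov_seed_rot t i j k : markov_seed t i j k -> markov_seed t j k i.
Proof. by move=> [o fr ps]; split=> //; exact: oriented_rot. Qed.

Lemma markov_seed_first t i j k l : markov_seed t i j k ->
  exists j' k', markov_seed t l j' k'.
Proof.
move=> m; have [[u _ _ _] _ _] := m.
have [->|->|->] := mem_triple l u.
- by exists j, k.
- by exists k, i; exact: markov_seed_rot.
- by exists i, j; exact: markov_seed_rot (markov_seed_rot m).
Qed.

Lemma markov_seed_mutate t i j k :
  markov_seed t i j k -> markov_seed (mutate t i) i k j.
Proof.
move=> [o fr ps]; split; first exact: oriented_mutate.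
- by move=> l; rewrite mutate_var_neq ?eq_rlshift.
- move=> a; have [->|ai] := eqVneq a (lshift 3 i).
    rewrite (mutate_var_self o fr).
    apply: positive_at_onesM; last exact: positive_at_onesV.
    apply: positive_at_onesD; apply: positive_at_onesM;
      by [exact: positive_at_onesX | exact: positive_at_ones_posY
        | exact: positive_at_ones_negY].
  by rewrite mutate_var_neq.
Qed.

Lemma seeds_ind (B : 'M[int]_(3 + 3, 3)) (Pr : seed -> Prop) :
  Pr (initial_seed K B) ->
  (forall t k, seeds K B t -> Pr t -> Pr (mutate t k)) ->
  forall t, seeds K B t -> Pr t.
Proof.
move=> P0 PS t [ks ->]; elim/last_ind: ks => [//|ks k IH].
by rewrite foldl_rcons; apply: PS => //; exists ks.
Qed.

Lemma seeds_initial (B : 'M[int]_(3 + 3, 3)) : seeds K B (initial_seed K B).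
Proof. by exists [::]. Qed.

Lemma seeds_mutate (B : 'M[int]_(3 + 3, 3)) t k :
  seeds K B t -> seeds K B (mutate t k).
Proof. by move=> [ks ->]; exists (rcons ks k); rewrite foldl_rcons. Qed.

Definition idx0 : 'I_3 := @Ordinal 3 0 isT.
Definition idx1 : 'I_3 := @Ordinal 3 1 isT.
Definition idx2 : 'I_3 := @Ordinal 3 2 isT.

Lemma markov_initial :
  markov_seed (initial_seed K markov_prin) idx0 idx1 idx2.
Proof.
split=> //; last by move=> a; exact: positive_at_ones_var.
by split=> //; split; rewrite mxE.
Qed.

Lemma markov_seeds t i : seeds K markov_prin t -> exists j k, markov_seed t i j k.
Proof.
move=> ts; move: t ts i.
apply: (@seeds_ind _ (fun t => forall i, exists j k, markov_seed t i j k))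
  => [i|t l _ IH i].
  exact: markov_seed_first markov_initial.
have [j [k m]] := IH l.
exact: markov_seed_first (markov_seed_mutate m).
Qed.

End MarkovSeeds.
(** * Elements of the upper cluster algebra *)

Section SubalgPred.
Variables (K : fieldType) (F : algType K) (G : set F).

Definition subalg_pred : {pred F} := [pred z | `[< subalg_gen G z >]].

Fact subalg_pred_closed : subalg_closed subalg_pred.
Proof.
split.
- by apply/asboolP; exact: subalg_gen1.
- by move=> a x y /asboolP hx /asboolP hy; apply/asboolP; exact: subalg_genZD.
- by move=> x y /asboolP hx /asboolP hy; apply/asboolP; exact: subalg_genM.
Qed.

HB.instance Definition _ :=
  GRing.isSubalgClosed.Build K F subalg_pred subalg_pred_closed.

End SubalgPred.

Lemma subalg_subring_closed (K : fieldType) (F : algType K) (S : subalgClosed F) :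
  subring_closed S.
Proof.
split=> [|x y hx hy|x y hx hy]; [exact: rpred1 | | exact: rpredM].
by rewrite -scaleN1r rpredD ?rpredZ.
Qed.

(** The mutation identities live over a bare field and speak of subrings, so a subalgebra predicate
    is repackaged to apply them. *)
Definition subring_of_subalg (K : fieldType) (F : algType K) (S : subalgClosed F) :
    subringClosed F :=
  HB.pack_for (subringClosed F) (S : {pred F})
    (GRing.isSubringClosed.Build F (S : {pred F}) (subalg_subring_closed S)).

Section MarkovGenerators.
Variable K : numFieldType.

Notation F := (ratfun K (3 + 3)).
Notation seed := (seed K 3 3).
Notation mutx t i := (seed_var t (lshift 3 i)).
Notation t0 := (initial_seed K markov_prin).
Implicit Types (t : seed) (B : 'M[int]_(3 + 3, 3)) (i j k l : 'I_3).

Section Subalgebra.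
Variable S : subalgClosed F.
Hypotheses (Sfrozen : forall l, frozen K l \in S)
  (SfrozenV : forall l, (frozen K l)^-1 \in S).

Definition has_gens t i j k : Prop :=
  markov_gens_in S (coefY K (seed_mx t) i) (coefY K (seed_mx t) j)
    (coefY K (seed_mx t) k) (mutx t i) (mutx t j) (mutx t k).

Lemma posY_in B i : posY K B i \in S.
Proof. by apply: rpred_prod => l _; exact: rpredX. Qed.

Lemma negY_in B i : negY K B i \in S.
Proof. by apply: rpred_prod => l _; exact: rpredX. Qed.

Lemma posYV_in B i : (posY K B i)^-1 \in S.
Proof. by rewrite -prodfV; apply: rpred_prod => l _; rewrite -exprVn rpredX. Qed.

Lemma negYV_in B i : (negY K B i)^-1 \in S.
Proof. by rewrite -prodfV; apply: rpred_prod => l _; rewrite -exprVn rpredX. Qed.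

Lemma coefY_in B i : coefY K B i \in S.
Proof. by apply: rpredM; [exact: posY_in | exact: negYV_in]. Qed.

Lemma coefYV_in B i : (coefY K B i)^-1 \in S.
Proof.
by rewrite invfM invrK; apply: rpredM; [exact: posYV_in | exact: negY_in].
Qed.

Lemma has_gens_mutate t i j k : markov_seed t i j k ->
  has_gens t i j k <-> has_gens (mutate t i) i k j.
Proof.
move=> m; have [o fr ps] := m; have [_ _ ps'] := markov_seed_mutate m.
have [u _ [_ _ ij] [_ ik _]] := o.
have /and3P[nij nik njk] : [&& i != j, i != k & j != k].
  by move: u; rewrite /= !inE negb_or andbT => /andP[/andP[-> ->] ->].
have zj : mutx (mutate t i) j = mutx t j.
  by rewrite mutate_var_neq // eq_lshift eq_sym.
have zk : mutx (mutate t i) k = mutx t k.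
  by rewrite mutate_var_neq // eq_lshift eq_sym.
have zi := mutate_var_self o fr.
have Bi : seed_mx (mutate t i) = mutate_mx (seed_mx t) i by [].
have Yi := coefY_mutate_self K (seed_mx t) i.
have Yj := coefY_mutate_neg K nij ij.
have Yk := coefY_mutate_pos K nik ik.
have nz a : mutx t a != 0 by exact/positive_at_ones_neq0/ps.
have zi'0 := positive_at_ones_neq0 (ps' (lshift 3 i)); rewrite zi in zi'0.
rewrite /has_gens zi zj zk Bi Yi Yj Yk.
exact: (markov_gens_in_mutate (S := subring_of_subalg S) _ (posY_neq0 K _ i) (negY_neq0 K _ i)
  (coefY_neq0 K _ k) (nz i) (nz j) (nz k) zi'0 (posY_in _ i) (posYV_in _ i)
  (negY_in _ i) (negYV_in _ i) (coefY_in _ k) (coefYV_in _ k)).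
Qed.

(** Induction along mutations, with [has_gens_mutate] as the step; the triple is existential because
    each mutation reverses it. Applied below both with [S] a Laurent ring and with [S] the upper
    cluster algebra. *)
Lemma has_gens_transfer t : seeds K markov_prin t ->
  exists i j k, markov_seed t i j k /\
    (has_gens t i j k <-> has_gens t0 idx0 idx1 idx2).
Proof.
move: t; apply: seeds_ind.
  by exists idx0, idx1, idx2; split=> //; exact: markov_initial.
move=> t l _ [i [j [k [m h]]]].
(* The triple is rotated so that the index to be mutated comes first. *)
have [j' [k' [m' h']]] : exists j' k', markov_seed t l j' k' /\
    (has_gens t l j' k' <-> has_gens t0 idx0 idx1 idx2).
  have [[u _ _ _] _ _] := m.
  have hr : has_gens t i j k <-> has_gens t j k i.
    exact: markov_gens_in_rot.
  have hr' : has_gens t i j k <-> has_gens t k i j.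
    by rewrite /has_gens markov_gens_in_rot markov_gens_in_rot.
  have [->|->|->] := mem_triple l u.
  - by exists j, k.
  - by exists k, i; split; [exact: markov_seed_rot | rewrite -hr].
  - exists i, j; split; last by rewrite -hr'.
    exact: markov_seed_rot (markov_seed_rot m).
exists l, k', j'; split; first exact: markov_seed_mutate.
by rewrite -has_gens_mutate.
Qed.

End Subalgebra.

Lemma seed_frozen t l : seeds K markov_prin t ->
  seed_var t (rshift 3 l) = frozen K l.
Proof. by move=> /(markov_seeds idx0)[j [k [_ ->]]]. Qed.

Lemma seed_var_neq0 t a : seeds K markov_prin t -> seed_var t a != 0.
Proof.
by move=> /(markov_seeds idx0)[j [k [_ _ ps]]]; exact/positive_at_ones_neq0/ps.
Qed.

Definition laurent_gens t : set F :=
  [set z | exists a : 'I_(3 + 3), z = seed_var t a \/ z = (seed_var t a)^-1].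

(** The denominators of the [X] and [W] formed from [t] are monomials in the variables of [t]. *)
Lemma laurent_has_gens t i j k : markov_seed t i j k ->
  has_gens (subalg_pred (laurent_gens t)) t i j k.
Proof.
move=> [o fr ps]; set S := subalg_pred _.
have Sz a : seed_var t a \in S.
  by apply/asboolP/subalg_gen_in; exists a; left.
have SzV a : (seed_var t a)^-1 \in S.
  by apply/asboolP/subalg_gen_in; exists a; right.
have SY a : coefY K (seed_mx t) a \in S.
  by apply: coefY_in => l; rewrite -fr.
have g i' j' k' : markov_gen_in S (coefY K (seed_mx t) i') (coefY K (seed_mx t) j')
    (coefY K (seed_mx t) k') (mutx t i') (mutx t j') (mutx t k').
  exact: (markov_gen_in_laurent (S := subring_of_subalg (subalg_pred (laurent_gens t)))).
by split.
Qed.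

(** For each seed [t], transfer with [S] the Laurent ring of [t]: it contains the generators formed
    from [t], hence those formed from the initial seed. Then intersect over all [t]. *)
Lemma upper_has_gens :
  has_gens (upper_cluster_algebra K markov_prin) t0 idx0 idx1 idx2.
Proof.
have h t : seeds K markov_prin t ->
    has_gens (subalg_pred (laurent_gens t)) t0 idx0 idx1 idx2.
  move=> ts.
  have hf l : frozen K l \in subalg_pred (laurent_gens t).
    rewrite -(seed_frozen l ts).
    by apply/asboolP/subalg_gen_in; exists (rshift 3 l); left.
  have hV l : (frozen K l)^-1 \in subalg_pred (laurent_gens t).
    rewrite -(seed_frozen l ts).
    by apply/asboolP/subalg_gen_in; exists (rshift 3 l); right.
  have [i [j [k [m <-]]]] := has_gens_transfer hf hV ts.
  exact: laurent_has_gens.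
by split; split; apply/asboolP => t /h [[? ? ?] [? ? ?] [? ? ?]]; exact/asboolP.
Qed.

Lemma upper_frozen l : frozen K l \in upper_cluster_algebra K markov_prin.
Proof.
apply/asboolP => t ts; rewrite -(seed_frozen l ts).
by apply: subalg_gen_in; exists (rshift 3 l); left.
Qed.

Lemma upper_frozenV l : (frozen K l)^-1 \in upper_cluster_algebra K markov_prin.
Proof.
apply/asboolP => t ts; rewrite -(seed_frozen l ts).
by apply: subalg_gen_in; exists (rshift 3 l); right.
Qed.

(** The Laurent phenomenon, by transfer in the other direction with [S] the upper cluster algebra:
    the generators formed from [t] include its mutable variables. *)
Lemma upper_seed_var t a : seeds K markov_prin t ->
  seed_var t a \in upper_cluster_algebra K markov_prin.
Proof.
move=> ts; rewrite -(splitK a); case: (fintype.split a) => i /=; last first.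
  by rewrite seed_frozen //; exact: upper_frozen.
have [i' [j [k [m [_ /(_ upper_has_gens) g]]]]] :=
  has_gens_transfer upper_frozen upper_frozenV ts.
have [[u _ _ _] _ _] := m; have [[? _ _] [? _ _] [? _ _]] := g.
by have [->|->|->] := mem_triple i u.
Qed.

Lemma cluster_seed_var t a : seeds K markov_prin t ->
  seed_var t a \in cluster_algebra K markov_prin.
Proof.
by move=> ts; apply/asboolP/subalg_gen_in; left; exists t => //; exists a.
Qed.

Lemma cluster_frozenV l : (frozen K l)^-1 \in cluster_algebra K markov_prin.
Proof. by apply/asboolP/subalg_gen_in; right; exists l. Qed.

End MarkovGenerators.
(** * Points fixed by an automorphism are deep *)

Section SpecPoints.
Variables (K : fieldType) (F : algType K) (S : subalgClosed F).

Lemma subalg_val_inj : injective (@subalg_val K F S).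
Proof. exact: val_inj. Qed.

Lemma subalg_valD (u v : subalg_sort S) :
  subalg_val (u + v) = subalg_val u + subalg_val v.
Proof. exact: (rmorphD (\val : subalg_sort S -> F)). Qed.

Lemma subalg_valM (u v : subalg_sort S) :
  subalg_val (u * v) = subalg_val u * subalg_val v.
Proof. exact: (rmorphM (\val : subalg_sort S -> F)). Qed.

Lemma subalg_val1 : subalg_val (1 : subalg_sort S) = 1.
Proof. exact: (rmorph1 (\val : subalg_sort S -> F)). Qed.

Lemma subalg_valZ c (u : subalg_sort S) : subalg_val (c *: u) = c *: subalg_val u.
Proof. exact: (linearZ_LR (\val : subalg_sort S -> F)). Qed.

Variable p : spec_points S.

(* Takes the junk value 0 outside of S. *)
Definition point_eval (z : F) : K := p (insubd 0 z).

Lemma subalg_insubdK (z : F) : z \in S ->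
  subalg_val (insubd (0 : subalg_sort S) z) = z.
Proof. exact: insubdK. Qed.

Lemma point_eval_val (u : subalg_sort S) : point_eval (subalg_val u) = p u.
Proof. by congr (p _); exact: valKd. Qed.

Lemma point_evalM x y : x \in S -> y \in S ->
  point_eval (x * y) = point_eval x * point_eval y.
Proof.
move=> hx hy; rewrite -{1}(subalg_insubdK hx) -{1}(subalg_insubdK hy).
by rewrite -subalg_valM point_eval_val rmorphM.
Qed.

Lemma point_evalD x y : x \in S -> y \in S ->
  point_eval (x + y) = point_eval x + point_eval y.
Proof.
move=> hx hy; rewrite -{1}(subalg_insubdK hx) -{1}(subalg_insubdK hy).
by rewrite -subalg_valD point_eval_val rmorphD.
Qed.

Lemma point_evalZ c x : x \in S -> point_eval (c *: x) = c * point_eval x.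
Proof.
move=> hx; rewrite -{1}(subalg_insubdK hx) -subalg_valZ point_eval_val.
exact: linearZ_LR.
Qed.

Lemma point_eval1 : point_eval 1 = 1.
Proof. by rewrite -subalg_val1 point_eval_val rmorph1. Qed.

Lemma point_evalX x n : x \in S -> point_eval (x ^+ n) = point_eval x ^+ n.
Proof.
move=> hx; elim: n => [|n IH]; first by rewrite !expr0 point_eval1.
by rewrite !exprS point_evalM ?rpredX // IH.
Qed.

Lemma point_eval_unit x y : x \in S -> y \in S -> x * y = 1 -> point_eval x != 0.
Proof.
move=> hx hy xy; have := oner_neq0 K; rewrite -point_eval1 -xy point_evalM //.
by rewrite mulf_eq0 negb_or => /andP[].
Qed.

End SpecPoints.

Section MarkovPoints.
Variable K : numFieldType.

Notation F := (ratfun K (3 + 3)).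
Notation seed := (seed K 3 3).
Notation mutx t i := (seed_var t (lshift 3 i)).
Notation t0 := (initial_seed K markov_prin).
Notation A := (subalg_sort (cluster_algebra K markov_prin)).
Implicit Types (t : seed) (i j k l : 'I_3).

Lemma markov_exchange t i j k : markov_seed t i j k ->
  mutx t i * mutx (mutate t i) i =
    posY K (seed_mx t) i * mutx t j ^+ 2 + negY K (seed_mx t) i * mutx t k ^+ 2.
Proof.
move=> [o fr ps]; rewrite (mutate_var_self o fr) mulrC divfK //.
exact/positive_at_ones_neq0/ps.
Qed.

Section FixedElements.
Variable phi : {lrmorphism A -> A}.

(** A property of rational functions, so that exchange relations can be used in the field rather
    than in [A]. *)
Definition fixed_elt (z : F) : Prop := exists2 a : A, subalg_val a = z & phi a = a.

Lemma fixed_eltD x y : fixed_elt x -> fixed_elt y -> fixed_elt (x + y).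
Proof.
move=> [a <- ha] [b <- hb]; exists (a + b); first by rewrite subalg_valD.
by rewrite -{2}ha -{2}hb; exact: rmorphD.
Qed.

Lemma fixed_eltM x y : fixed_elt x -> fixed_elt y -> fixed_elt (x * y).
Proof.
move=> [a <- ha] [b <- hb]; exists (a * b); first by rewrite subalg_valM.
by rewrite -{2}ha -{2}hb; exact: rmorphM.
Qed.

Lemma fixed_eltZ c x : fixed_elt x -> fixed_elt (c *: x).
Proof.
move=> [a <- ha]; exists (c *: a); first by rewrite subalg_valZ.
by rewrite -{2}ha; exact: linearZ_LR.
Qed.

Lemma fixed_elt1 : fixed_elt 1.
Proof. by exists 1; [exact: subalg_val1 | exact: rmorph1]. Qed.

Lemma fixed_eltX x n : fixed_elt x -> fixed_elt (x ^+ n).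
Proof.
move=> hx; elim: n => [|n IH]; first by rewrite expr0; exact: fixed_elt1.
by rewrite exprS; exact: fixed_eltM.
Qed.

(** Multiplicativity of [phi], then cancellation of [x] in the field. *)
Lemma fixed_elt_div x y : x != 0 -> y \in cluster_algebra K markov_prin ->
  fixed_elt x -> fixed_elt (x * y) -> fixed_elt y.
Proof.
move=> x0 hy [a ax pa] [b bxy pb]; exists (SubalgElt hy) => //.
apply: subalg_val_inj; apply: (mulfI x0); rewrite -ax -!subalg_valM.
have ab : a * SubalgElt hy = b by apply: subalg_val_inj; rewrite subalg_valM ax bxy.
have e : phi (a * SubalgElt hy) = phi a * phi (SubalgElt hy) by exact: rmorphM.
by rewrite ab pb pa in e; rewrite -e ab.
Qed.

Definition fixed_seed t : Prop := forall a, fixed_elt (seed_var t a).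

(* The exchange relation x x' = b has a right-hand side b in the variables common
   to both seeds; fixing b and x fixes x', and conversely. *)
Lemma fixed_seed_mutate t i : seeds K markov_prin t ->
  fixed_seed t <-> fixed_seed (mutate t i).
Proof.
move=> ts; have ts' := seeds_mutate i ts.
have [j [k m]] := markov_seeds i ts; have [[u _ _ _] _ _] := m.
have /andP[nij nik] : (i != j) && (i != k).
  by move: u; rewrite /= !inE negb_or andbT => /andP[/andP[-> ->] _].
have fr' t' : seeds K markov_prin t' -> fixed_seed t' ->
    forall l, fixed_elt (frozen K l).
  by move=> ts1 ft l; rewrite -(seed_frozen l ts1).
have fP B : (forall l, fixed_elt (frozen K l)) ->
    fixed_elt (posY K B i) /\ fixed_elt (negY K B i).
  move=> h; split; apply: (big_ind fixed_elt);
    by [exact: fixed_elt1 | exact: fixed_eltM | move=> l _; exact: fixed_eltX].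
have fb : (forall l, fixed_elt (frozen K l)) -> fixed_elt (mutx t j) ->
    fixed_elt (mutx t k) -> fixed_elt (mutx t i * mutx (mutate t i) i).
  move=> h hj hk; rewrite (markov_exchange m); have [hP hQ] := fP (seed_mx t) h.
  by apply: fixed_eltD; apply: fixed_eltM => //; exact: fixed_eltX.
have zj : mutx (mutate t i) j = mutx t j.
  by rewrite mutate_var_neq // eq_lshift eq_sym.
have zk : mutx (mutate t i) k = mutx t k.
  by rewrite mutate_var_neq // eq_lshift eq_sym.
split=> ft a; have [->|ai] := eqVneq a (lshift 3 i).
- apply: (fixed_elt_div (seed_var_neq0 (lshift 3 i) ts)).
  + exact: cluster_seed_var.
  + exact: ft.
  + by apply: fb => //; exact: fr' ft.
- by rewrite mutate_var_neq.
- apply: (fixed_elt_div (seed_var_neq0 (lshift 3 i) ts')).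
  + exact: cluster_seed_var.
  + exact: ft.
  + by rewrite mulrC; apply: fb; [exact: fr' ft | rewrite -zj | rewrite -zk].
- by rewrite -(mutate_var_neq t ai).
Qed.

Lemma fixed_seed_initial t : seeds K markov_prin t -> fixed_seed t <-> fixed_seed t0.
Proof.
move: t; apply: seeds_ind => // t i ts IH.
by rewrite -fixed_seed_mutate.
Qed.

(** Fixedness spreads from one seed to all, hence to all generators of [A]; the inverses of frozen
    variables follow by division. *)
Lemma fixed_seed_id t : seeds K markov_prin t -> fixed_seed t ->
  forall a, phi a = a.
Proof.
move=> ts /(fixed_seed_initial ts) f0 a.
suff [b ba pb] : fixed_elt (subalg_val a) by rewrite -(subalg_val_inj ba).
have /asboolP := valP a; elim.
- move=> x [[t' ts' [c ->]]|[l ->]].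
    by move: c; apply/(fixed_seed_initial ts').
  apply: (@fixed_elt_div (frozen K l)); first exact: frozen_neq0.
  + exact: cluster_frozenV.
  + exact: f0.
  + by rewrite mulfV ?frozen_neq0 //; exact: fixed_elt1.
- exact: fixed_elt1.
- by move=> c x y _ hx _ hy; apply: fixed_eltD => //; exact: fixed_eltZ.
- by move=> x y _ hx _ hy; exact: fixed_eltM.
Qed.

End FixedElements.

(** At a point in the torus of [t], each variable of [t] is scaled by some [e] while its nonzero
    value is preserved, so [e = 1]. The automorphism then fixes the seed and is trivial. The
    argument covers both algebras. *)
Lemma stabilized_sub_deep (S : subalgClosed F) :
  stabilized_locus markov_prin S `<=` deep_locus markov_prin S.
Proof.
move=> p [phi [[_ phi_sc] [a phia] [psi ext stab]]] [t ts pt].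
apply/negP: phia; rewrite negbK; apply/eqP; move: a.
apply: (fixed_seed_id ts) => b; have [u ub pu] := pt b.
pose c : A := SubalgElt (cluster_seed_var b ts).
exists c => //; have [e e0 phic] := phi_sc t b c ts erefl.
have psiu : psi u = e *: u.
  apply: subalg_val_inj; rewrite subalg_valZ.
  have cu : subalg_val c = subalg_val u by rewrite [RHS]ub.
  by rewrite -cu -subalg_valZ -phic; exact/esym/ext.
have eu : p (e *: u) = e * p u by exact: linearZ_LR.
have e1 : e = 1 by apply: (mulIf pu); rewrite mul1r -eu -psiu stab.
rewrite phic e1; exact: scale1r.
Qed.

End MarkovPoints.
(** * Deep points of the cluster algebra are fixed *)

Section ZeroPattern.
Variable K : numFieldType.

Notation F := (ratfun K (3 + 3)).
Notation mutx t i := (seed_var t (lshift 3 i)).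
Notation t0 := (initial_seed K markov_prin).
Implicit Types (t : seed K 3 3) (i j k l : 'I_3).

Variable S : subalgClosed F.
(** [S] stays general because [zero_pattern] is applied to the cluster algebra and [all_zero_deep]
    to the upper one. *)
Hypothesis S_var : forall t a, seeds K markov_prin t -> seed_var t a \in S.
Hypothesis S_frozenV : forall l, (frozen K l)^-1 \in S.
Variable p : spec_points S.

Notation ev := (point_eval p).

Lemma S_frozen l : frozen K l \in S.
Proof. exact: (S_var (rshift 3 l) (seeds_initial K markov_prin)). Qed.

Lemma point_frozen_neq0 l : ev (frozen K l) != 0.
Proof.
apply: point_eval_unit (S_frozen l) (S_frozenV l) _.
by rewrite mulfV ?frozen_neq0.
Qed.

Lemma point_exchange t i j k : seeds K markov_prin t -> markov_seed t i j k ->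
  exists P Q : K, [/\ P != 0, Q != 0 &
    ev (mutx t i) * ev (mutx (mutate t i) i) =
      P * ev (mutx t j) ^+ 2 + Q * ev (mutx t k) ^+ 2].
Proof.
move=> ts m; have ts' := seeds_mutate i ts.
have P_in := posY_in S_frozen (seed_mx t) i.
have Q_in := negY_in S_frozen (seed_mx t) i.
exists (ev (posY K (seed_mx t) i)), (ev (negY K (seed_mx t) i)); split.
- apply: point_eval_unit P_in (posYV_in S_frozenV (seed_mx t) i) _.
  by rewrite mulfV ?posY_neq0.
- apply: point_eval_unit Q_in (negYV_in S_frozenV (seed_mx t) i) _.
  by rewrite mulfV ?negY_neq0.
have hj := S_var (lshift 3 j) ts; have hk := S_var (lshift 3 k) ts.
have hj2 : mutx t j ^+ 2 \in S by exact: rpredX.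
have hk2 : mutx t k ^+ 2 \in S by exact: rpredX.
rewrite -(point_evalM _ (S_var (lshift 3 i) ts) (S_var (lshift 3 i) ts')).
rewrite (markov_exchange m) point_evalD; [|exact: rpredM..].
by rewrite !point_evalM // !point_evalX.
Qed.

Lemma in_cluster_torus t : seeds K markov_prin t ->
  (forall a, ev (seed_var t a) != 0) -> cluster_torus t p.
Proof.
move=> ts h a; exists (SubalgElt (S_var a ts)); first by [].
by rewrite -point_eval_val; exact: h.
Qed.

(** Frozen variables are units, so only a mutable variable can keep [p] out of the torus of [t]. *)
Lemma deep_mutable_zero t : deep_locus markov_prin S p ->
  seeds K markov_prin t -> exists l, ev (mutx t l) = 0.
Proof.
move=> dp ts; apply: contrapT => /forallNP h; apply: dp; exists t => //.
apply: in_cluster_torus => // a; rewrite -(splitK a).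
case: (fintype.split a) => l /=; first exact/eqP/h.
by rewrite seed_frozen ?point_frozen_neq0.
Qed.

Lemma mutate_mutx t i j : j != i -> mutx (mutate t i) j = mutx t j.
Proof. by move=> ji; rewrite mutate_var_neq // eq_lshift. Qed.

Lemma markov_neq t i j k : markov_seed t i j k -> [/\ i != j, i != k & j != k].
Proof.
case=> [[u _ _ _] _ _]; move: u; rewrite /= !inE negb_or andbT.
by move=> /andP[/andP[-> ->] ->].
Qed.

(* Were x_i' nonzero, the exchange relation at another index k of the mutated
   seed would read 0 = Q x_i'^2. *)
Lemma all_zero_mutate t i : seeds K markov_prin t ->
  (forall l, ev (mutx t l) = 0) -> forall l, ev (mutx (mutate t i) l) = 0.
Proof.
move=> ts z l; have [->|li] := eqVneq l i; last by rewrite mutate_mutx.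
have [j [k m]] := markov_seeds i ts; have [nij nik njk] := markov_neq m.
have m' := markov_seed_rot (markov_seed_mutate m).
have [P [Q [P0 Q0]]] := point_exchange (seeds_mutate i ts) m'.
rewrite (@mutate_mutx t i k) 1?eq_sym // (@mutate_mutx t i j) 1?eq_sym //.
rewrite !z mul0r expr0n mulr0 add0r => /esym/eqP.
by rewrite mulf_eq0 (negbTE Q0) /= sqrf_eq0 => /eqP.
Qed.

Lemma all_zero_seeds : (forall l, ev (mutx t0 l) = 0) ->
  forall t, seeds K markov_prin t -> forall l, ev (mutx t l) = 0.
Proof.
move=> z; apply: seeds_ind => // t i ts zt.
exact: all_zero_mutate.
Qed.

Lemma all_zero_deep : (forall l, ev (mutx t0 l) = 0) -> deep_locus markov_prin S p.
Proof.
move=> z [t ts /(_ (lshift 3 idx0))[u uv]]; apply/negP; rewrite negbK.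
rewrite -point_eval_val; apply/eqP.
by rewrite [subalg_val u]uv (all_zero_seeds z ts).
Qed.

Definition one_zero t i : Prop := forall l, (ev (mutx t l) == 0) = (l == i).

(** Mutation at [i] keeps the two nonzero variables, so deepness forces the new one to vanish.
    Mutation elsewhere has an exchange relation with exactly one nonzero term on the right, so the
    new variable does not vanish. *)
Lemma one_zero_mutate t i l : deep_locus markov_prin S p ->
  seeds K markov_prin t -> one_zero t i -> one_zero (mutate t l) i.
Proof.
move=> dp ts z; have [li|li] := eqVneq l i.
  have nz a : a != i -> ev (mutx (mutate t l) a) != 0.
    by move=> ai; rewrite li mutate_mutx // z.
  have [b zb] := deep_mutable_zero dp (seeds_mutate l ts).
  have bi : b = i by apply/eqP; apply: contraTT (eqxx (0 : K)) => /nz; rewrite zb.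
  move=> a; have [->|ai] := eqVneq a i; first by rewrite -bi zb eqxx.
  exact/negbTE/nz.
move=> a; have [->|al] := eqVneq a l; last by rewrite mutate_mutx // z.
have [j [k m]] := markov_seeds l ts; have [nlj nlk njk] := markov_neq m.
have [P [Q [P0 Q0 e]]] := point_exchange ts m.
rewrite (negbTE li); apply: contraTF (eqxx (0 : K)) => /eqP zl.
move: e; rewrite zl mulr0 => e.
have [[u _ _ _] _ _] := m.
have [il|ij|ik] := mem_triple i u; first by rewrite il eqxx in li.
- have /eqP zj : ev (mutx t j) == 0 by rewrite z ij.
  have zk : ev (mutx t k) != 0 by rewrite z ij eq_sym.
  move/esym/eqP: e; rewrite zj expr0n mulr0 add0r.
  by rewrite (negbTE (mulf_neq0 Q0 (expf_neq0 2 zk))).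
- have /eqP zk : ev (mutx t k) == 0 by rewrite z ik.
  have zj : ev (mutx t j) != 0 by rewrite z ik.
  move/esym/eqP: e; rewrite zk expr0n mulr0 addr0.
  by rewrite (negbTE (mulf_neq0 P0 (expf_neq0 2 zj))).
Qed.

Lemma initial_zero_pattern : deep_locus markov_prin S p ->
  (forall l, ev (mutx t0 l) = 0) \/ exists i, one_zero t0 i.
Proof.
move=> dp; have ts := seeds_initial K markov_prin.
have [i zi] := deep_mutable_zero dp ts.
have [j [k m]] := markov_seeds i ts; have [nij nik njk] := markov_neq m.
have [P [Q [P0 Q0]]] := point_exchange ts m; rewrite zi mul0r => e.
have [[u _ _ _] _ _] := m.
(* As [x_i] vanishes, the exchange relation reads [0 = P x_j^2 + Q x_k^2]: the other two variables
   vanish together. *)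
have jk : (ev (mutx t0 j) == 0) = (ev (mutx t0 k) == 0).
  apply/eqP/eqP => z; move/esym/eqP: e; rewrite z expr0n mulr0.
    by rewrite add0r mulf_eq0 (negbTE Q0) /= sqrf_eq0 => /eqP.
  by rewrite addr0 mulf_eq0 (negbTE P0) /= sqrf_eq0 => /eqP.
have [zj|zj] := eqVneq (ev (mutx t0 j)) 0.
  left=> l; have [->|->|->] := mem_triple l u => //.
  by apply/eqP; rewrite -jk zj.
right; exists i => l; have [->|->|->] := mem_triple l u; rewrite ?zi ?eqxx //.
- by rewrite (negbTE zj) eq_sym (negbTE nij).
- by rewrite -jk (negbTE zj) eq_sym (negbTE nik).
Qed.

(** A single [Z] serves all seeds, which is what lets one sign change fix the point. *)
Lemma zero_pattern : deep_locus markov_prin S p ->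
  exists Z : pred 'I_3, (exists i, Z i) /\
    forall t, seeds K markov_prin t -> forall l, Z l = (ev (mutx t l) == 0).
Proof.
move=> dp; have [z|[i z]] := initial_zero_pattern dp.
  exists predT; split; first by exists idx0.
  by move=> t ts l; rewrite (all_zero_seeds z ts) eqxx.
exists (pred1 i); split; first by exists i; exact: eqxx.
move=> t ts l; suff -> : one_zero t i by [].
move: t ts {l}; apply: seeds_ind => // t l ts.
exact: one_zero_mutate.
Qed.

End ZeroPattern.

(** * Restriction of field endomorphisms to subalgebras *)

Section RestrictEndomorphism.
Variables (K : fieldType) (F : algType K) (S : subalgClosed F).
Variable Phi : {lrmorphism F -> F}.
Hypothesis Phi_S : forall z, z \in S -> Phi z \in S.

Definition restrict_endo (a : subalg_sort S) : subalg_sort S :=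
  SubalgElt (Phi_S (valP a)).

Lemma restrict_endo_val a : subalg_val (restrict_endo a) = Phi (subalg_val a).
Proof. by []. Qed.

Fact restrict_endo_zmod : zmod_morphism restrict_endo.
Proof.
move=> a b; apply: val_inj; apply: etrans (esym (rmorphB (\val) _ _)).
apply: etrans (rmorphB Phi _ _); congr (Phi _); exact: (rmorphB (\val)).
Qed.

Fact restrict_endo_monoid : monoid_morphism restrict_endo.
Proof.
split=> [|a b]; apply: subalg_val_inj; rewrite restrict_endo_val.
  by rewrite subalg_val1; exact: rmorph1.
by rewrite !subalg_valM !restrict_endo_val; exact: rmorphM.
Qed.

Fact restrict_endo_scalable : scalable restrict_endo.
Proof.
move=> c a; apply: subalg_val_inj.
rewrite restrict_endo_val !subalg_valZ restrict_endo_val; exact: linearZ_LR.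
Qed.

HB.instance Definition _ := GRing.isZmodMorphism.Build
  (subalg_sort S) (subalg_sort S) restrict_endo restrict_endo_zmod.
HB.instance Definition _ := GRing.isMonoidMorphism.Build
  (subalg_sort S) (subalg_sort S) restrict_endo restrict_endo_monoid.
HB.instance Definition _ := GRing.isScalable.Build
  K (subalg_sort S) (subalg_sort S) *:%R restrict_endo restrict_endo_scalable.

Definition restricted_endo : {lrmorphism subalg_sort S -> subalg_sort S} :=
  restrict_endo.

End RestrictEndomorphism.

(** * Sign changes on the field of rational functions *)

Section SignChange.
Variables (K : fieldType) (N : nat) (s : 'I_N -> K).
Hypothesis s_sq : forall a, s a * s a = 1.

Notation F := (ratfun K N).

Definition mpoly_sign : {mpoly K[N]} -> {mpoly K[N]} :=
  mmap (@mpolyC N K) (fun a => s a *: 'X_a).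

HB.instance Definition _ := GRing.RMorphism.copy mpoly_sign
  (mmap (@mpolyC N K) (fun a => s a *: 'X_a)).

Lemma mpoly_signC c : mpoly_sign c%:MP = c%:MP.
Proof. exact: mmapC. Qed.

Lemma mpoly_signX a : mpoly_sign 'X_a = s a *: 'X_a.
Proof. by rewrite /mpoly_sign mmapX mmap1U. Qed.

Lemma mpoly_signK : involutive mpoly_sign.
Proof.
have sD : {morph mpoly_sign : x y / x + y} by exact: rmorphD.
have sM : {morph mpoly_sign : x y / x * y} by exact: rmorphM.
elim/mpolyind=> [|c m q _ _ IH]; first by rewrite /mpoly_sign !mmap0.
rewrite !sD IH -!mul_mpolyC !sM !mpoly_signC; congr (_ * _ + _).
rewrite mpolyXE_id; elim/big_rec: _ => [|a x _ IHx].
  by rewrite !(rmorph1 mpoly_sign).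
rewrite !sM IHx; congr (_ * _); elim: (m a) => [|n IHn].
  by rewrite !expr0 !(rmorph1 mpoly_sign).
rewrite exprS !sM IHn mpoly_signX -mul_mpolyC sM mpoly_signC mpoly_signX.
by rewrite -mul_mpolyC mulrA -mpolyCM s_sq mul1r.
Qed.

Definition tofrac_sign : {mpoly K[N]} -> {fraction {mpoly K[N]}} :=
  @tofrac _ \o mpoly_sign.

HB.instance Definition _ := GRing.RMorphism.copy tofrac_sign
  (@tofrac {mpoly K[N]} \o mpoly_sign).

Lemma tofrac_sign_inj : injective tofrac_sign.
Proof.
move=> q q' /eqP; rewrite tofrac_eq => /eqP; exact: (inv_inj mpoly_signK).
Qed.

(** The sign change of polynomials is an involution, hence injective; by [frac_local_inj] no
    fraction gets the default value, and this is a field endomorphism. *)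
Definition ratfun_sign (z : F) : F := evalfrac tofrac_sign z.

Lemma ratfun_sign_tofrac q : ratfun_sign (tofrac q) = tofrac (mpoly_sign q).
Proof. exact: evalfrac_tofrac. Qed.

Fact ratfun_sign_monoid : monoid_morphism ratfun_sign.
Proof.
split=> [|x y]; last by apply: evalfracM; exact: frac_local_inj tofrac_sign_inj.
by apply: etrans (ratfun_sign_tofrac 1) _; rewrite rmorph1; exact: tofrac1.
Qed.

Fact ratfun_sign_scalable : scalable ratfun_sign.
Proof.
move=> c x; apply: etrans (ratfun_sign_monoid.2 (ratfunC N c) x) _.
by rewrite ratfun_sign_tofrac mpoly_signC.
Qed.

Fact ratfun_sign_zmod : zmod_morphism ratfun_sign.
Proof.
move=> x y; have l := fun z => frac_local_inj z tofrac_sign_inj.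
have e : ratfun_sign (- y) = - ratfun_sign y.
  by rewrite -scaleN1r ratfun_sign_scalable scaleN1r.
rewrite -e; exact: (evalfracD (l x) (l (- y))).
Qed.

HB.instance Definition _ := GRing.isZmodMorphism.Build F F ratfun_sign
  ratfun_sign_zmod.
HB.instance Definition _ := GRing.isMonoidMorphism.Build F F ratfun_sign
  ratfun_sign_monoid.
HB.instance Definition _ := GRing.isScalable.Build K F F *:%R ratfun_sign
  ratfun_sign_scalable.

Definition sign_endo : {lrmorphism F -> F} := ratfun_sign.

Lemma sign_endo_var a : sign_endo (tofrac 'X_a) = s a *: (tofrac 'X_a : F).
Proof.
apply: etrans (ratfun_sign_tofrac _) _.
by rewrite mpoly_signX -mul_mpolyC tofracM.
Qed.

End SignChange.

(** * Sign automorphisms of the cluster algebra and its deep points *)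

Section DeepStabilized.
Variable K : numFieldType.

Notation F := (ratfun K (3 + 3)).
Notation mutx t i := (seed_var t (lshift 3 i)).
Notation A := (subalg_sort (cluster_algebra K markov_prin)).
Implicit Types (t : seed K 3 3) (i j k l : 'I_3).

Section SignAction.
Variable Z : pred 'I_3.

Definition index_sign (a : 'I_(3 + 3)) : K :=
  if fintype.split a is inl l then (-1) ^+ Z l else 1.

Lemma index_sign_sq a : index_sign a * index_sign a = 1.
Proof.
rewrite /index_sign; case: (fintype.split a) => [l|_]; rewrite ?mulr1 //.
by rewrite -signr_addb addbb.
Qed.

Lemma index_sign_mutable l : index_sign (lshift 3 l) = (-1) ^+ Z l.
Proof. by rewrite /index_sign (unsplitK (inl l : 'I_3 + 'I_3)). Qed.

Lemma index_sign_frozen l : index_sign (rshift 3 l) = 1.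
Proof. by rewrite /index_sign (unsplitK (inr l : 'I_3 + 'I_3)). Qed.

Let Phi : {lrmorphism F -> F} := sign_endo index_sign_sq.

Let PhiM : {morph Phi : x y / x * y}.
Proof. exact: rmorphM. Qed.

Let PhiD : {morph Phi : x y / x + y}.
Proof. exact: rmorphD. Qed.

Let PhiX n : {morph Phi : x / x ^+ n}.
Proof. exact: rmorphXn. Qed.

Let PhiV : {morph Phi : x / x^-1}.
Proof. exact: fmorphV. Qed.

Let PhiZ c : {morph Phi : x / c *: x}.
Proof. exact: linearZ_LR. Qed.

Lemma sign_frozen l : Phi (frozen K l) = frozen K l.
Proof.
apply: etrans (sign_endo_var _ _) _; rewrite index_sign_frozen; exact: scale1r.
Qed.

Lemma sign_posY B i : Phi (posY K B i) = posY K B i.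
Proof.
apply: (big_ind (fun x => Phi x = x)) => [|x y hx hy|l _].
- exact: rmorph1.
- by rewrite PhiM hx hy.
- by rewrite PhiX sign_frozen.
Qed.

Lemma sign_negY B i : Phi (negY K B i) = negY K B i.
Proof.
apply: (big_ind (fun x => Phi x = x)) => [|x y hx hy|l _].
- exact: rmorph1.
- by rewrite PhiM hx hy.
- by rewrite PhiX sign_frozen.
Qed.

Lemma sign_square x a : Phi x = index_sign a *: x -> Phi (x ^+ 2) = x ^+ 2.
Proof.
move=> e; rewrite expr2 PhiM e -scalerAl -scalerAr scalerA index_sign_sq.
exact: scale1r.
Qed.

(** The right-hand side of an exchange relation involves only frozen variables and squares of
    mutable ones, so it is fixed; hence [x_i'] changes by the same sign as [x_i]. *)
Lemma sign_seed t : seeds K markov_prin t ->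
  forall a, Phi (seed_var t a) = index_sign a *: seed_var t a.
Proof.
move: t; apply: seeds_ind => [a|t i ts IH a]; first exact: sign_endo_var.
have [->|ai] := eqVneq a (lshift 3 i); last by rewrite mutate_var_neq.
have [j [k m]] := markov_seeds i ts; have e := markov_exchange m.
have := congr1 Phi e.
rewrite PhiD (PhiM (seed_var t _)) (PhiM (posY _ _ _)) (PhiM (negY _ _ _)).
rewrite sign_posY sign_negY.
rewrite (sign_square (IH (lshift 3 j))) (sign_square (IH (lshift 3 k))) -e IH.
rewrite -scalerAl => h; apply: (mulfI (seed_var_neq0 (lshift 3 i) ts)).
rewrite -scalerAr -h scalerA index_sign_sq; exact/esym/scale1r.
Qed.

(** One induction gives both facts: stability, to restrict [Phi] to [A], and involutivity, to make
    the restriction bijective. *)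
Lemma sign_cluster z : z \in cluster_algebra K markov_prin ->
  Phi z \in cluster_algebra K markov_prin /\ Phi (Phi z) = z.
Proof.
have P1 : Phi 1 = 1 by exact: rmorph1.
move=> /asboolP; elim.
- move=> x [[t ts [a ->]]|[l ->]].
    rewrite (sign_seed ts); split; first by rewrite rpredZ // cluster_seed_var.
    by rewrite PhiZ (sign_seed ts) scalerA index_sign_sq; exact: scale1r.
  have -> : Phi (frozen K l)^-1 = (frozen K l)^-1.
    by rewrite PhiV sign_frozen.
  have -> : Phi (frozen K l)^-1 = (frozen K l)^-1.
    by rewrite PhiV sign_frozen.
  by split; first exact: cluster_frozenV.
- by rewrite !P1; split=> //; exact: rpred1.
- move=> c x y _ [hx ex] _ [hy ey]; rewrite !PhiD !PhiZ ex ey; split=> //.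
  by rewrite rpredD // rpredZ.
- move=> x y _ [hx ex] _ [hy ey]; rewrite !PhiM ex ey; split=> //.
  exact: rpredM.
Qed.

Definition sign_aut : {lrmorphism A -> A} :=
  restricted_endo (fun z hz => (sign_cluster hz).1).

Lemma sign_aut_val (a : A) : subalg_val (sign_aut a) = Phi (subalg_val a).
Proof. by []. Qed.

Lemma sign_autK : involutive sign_aut.
Proof.
move=> a; apply: subalg_val_inj; rewrite !sign_aut_val.
exact: (sign_cluster (valP a)).2.
Qed.

Lemma sign_cluster_aut : cluster_aut sign_aut.
Proof.
split; first exact/inv_bij/sign_autK.
move=> t a u ts ua; exists (index_sign a).
  by apply: contraTneq (oner_neq0 K) => s0; rewrite -(index_sign_sq a) s0 mul0r eqxx.
apply: subalg_val_inj; rewrite sign_aut_val subalg_valZ.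
by rewrite [subalg_val u]ua sign_seed.
Qed.

Lemma sign_aut_neq i : Z i -> exists a, sign_aut a != a.
Proof.
move=> Zi; have ts := seeds_initial K markov_prin.
exists (SubalgElt (cluster_seed_var (lshift 3 i) ts)).
apply/eqP => /(congr1 (@subalg_val _ _ _)); rewrite sign_aut_val /=.
rewrite (sign_seed ts) index_sign_mutable Zi expr1 scaleN1r => /eqP.
(* [x] differs from [- x] because [x + x] has a positive value at the point with all coordinates
   [1]. *)
have p2 := positive_at_ones_var K (lshift 3 i).
have /eqP n0 := positive_at_ones_neq0 (positive_at_onesD p2 p2).
by rewrite eq_sym -addr_eq0 => /eqP /n0.
Qed.

(** A variable whose sign is changed vanishes at [p], so its value is preserved; the other
    generators are themselves fixed. *)
Lemma sign_aut_fix (p : spec_points (cluster_algebra K markov_prin)) :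
  (forall t, seeds K markov_prin t ->
     forall l, Z l = (point_eval p (mutx t l) == 0)) ->
  forall u, p (sign_aut u) = p u.
Proof.
move=> hZ u; rewrite -!point_eval_val sign_aut_val.
have /asboolP := valP u; elim.
- move=> x [[t ts [a ->]]|[l ->]].
    rewrite (sign_seed ts) point_evalZ ?cluster_seed_var // -(splitK a).
    case: (fintype.split a) => l /=; last by rewrite index_sign_frozen mul1r.
    rewrite index_sign_mutable; case Zl: (Z l); last by rewrite mul1r.
    by move: Zl; rewrite (hZ t ts) => /eqP ->; rewrite mulr0.
  by congr (point_eval p _); rewrite PhiV; congr (_^-1); exact: sign_frozen.
- by congr (point_eval p _); exact: rmorph1.
- move=> c x y /asboolP hx ex /asboolP hy ey; rewrite PhiD PhiZ.
  have [hx' _] := sign_cluster hx; have [hy' _] := sign_cluster hy.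
  by rewrite !point_evalD ?rpredZ // !point_evalZ // ex ey.
- move=> x y /asboolP hx ex /asboolP hy ey; rewrite PhiM.
  have [hx' _] := sign_cluster hx; have [hy' _] := sign_cluster hy.
  by rewrite !point_evalM // ex ey.
Qed.

End SignAction.

Lemma deep_sub_stabilized :
  deep_locus markov_prin (cluster_algebra K markov_prin) `<=`
  stabilized_locus markov_prin (cluster_algebra K markov_prin).
Proof.
move=> p dp.
have [Z [[i Zi] hZ]] := zero_pattern (@cluster_seed_var K) (@cluster_frozenV K) dp.
exists (sign_aut Z); split.
- exact: sign_cluster_aut.
- exact: sign_aut_neq Zi.
- exists (sign_aut Z); last exact: sign_aut_fix.
  by move=> a u /val_inj ->.
Qed.

End DeepStabilized.
(** * A mysterious point of the upper cluster algebra *)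

Section PoleRemoval.
Variable R0 : idomainType.

(** [c] is a root of [P * B] but not of [B], hence of [P]; divide by one linear factor and
    repeat. *)
Lemma dvd_linear_power (c : R0) n (P B H : {poly R0}) :
  P * B = ('X - c%:P) ^+ n * H -> B.[c] != 0 -> exists P', P = ('X - c%:P) ^+ n * P'.
Proof.
elim: n P => [|n IH] P; first by exists P; rewrite expr0 mul1r.
move=> e Bc; have : root (P * B) c.
  by rewrite e exprS -mulrA rootM root_XsubC eqxx.
rewrite rootM => /orP[/factor_theorem[P1 eP]|]; last by rewrite /root (negbTE Bc).
have [|P' eP1] := IH P1 _ Bc.
  apply: (mulIf (negbT (polyXsubC_eq0 c))); move: e; rewrite eP exprS => e.
  by rewrite -mulrA [B * _]mulrC mulrA e; ring.
by exists P'; rewrite eP eP1 exprS; ring.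
Qed.

(** The second presentation has a denominator nonzero at ['X = c], so [e] has no pole there and the
    linear factor drops out of the first denominator. *)
Lemma pole_removal (e : {fraction {poly R0}}) (c : R0) n (A B P Q : {poly R0}) :
  e * tofrac (('X - c%:P) ^+ n * A) = tofrac P -> e * tofrac B = tofrac Q ->
  B.[c] != 0 -> exists P', e * tofrac A = tofrac P'.
Proof.
move=> eP eQ Bc; have [|P' hP'] := @dvd_linear_power c n P B (A * Q) _ Bc.
  by apply/eqP; rewrite -tofrac_eq !tofracM -eP -eQ tofracM; apply/eqP; ring.
exists P'; have f0 : tofrac (('X - c%:P) ^+ n) != 0 :> {fraction {poly R0}}.
  by rewrite tofrac_eq0 expf_neq0 // polyXsubC_eq0.
by apply: (mulfI f0); rewrite -tofracM -hP' -eP tofracM; ring.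
Qed.

End PoleRemoval.

Lemma common_denominator (R : comPzRingType) (c x y a b G H : R) :
  x * a = G -> y * b = H -> (c * x + y) * (a * b) = c * G * b + H * a.
Proof. by move=> <- <-; ring. Qed.

(** * Restriction of rational functions to a plane through the mysterious point *)

Section Slice.
Variables (K : numFieldType) (im : K).
Hypothesis im_sq : im * im = -1.

Notation F := (ratfun K (3 + 3)).
Notation D := {poly {poly K}}.
Notation E := {fraction {poly {poly K}}}.
Notation mutx t i := (seed_var t (lshift 3 i)).
Notation t0 := (initial_seed K markov_prin).
Implicit Types (t : seed K 3 3) (i j k l : 'I_3).

Let I : D := im%:P%:P.
Let Y : D := 'X%:P.
Let I_sq : I * I = -1.
Proof. by rewrite -!polyCM im_sq !polyCN. Qed.

(* The plane of the header in the coordinates 'X, Y with s = 2 Y - 'X and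
   r = 2 i ('X - Y), which make x_1, x_2, x_3 linear in the outer variable 'X with
   constant leading coefficient. *)
Definition slice_x3 : D := 2 * I * ('X - Y).

Definition slice_mutable l : D := nth 0 [:: 'X; 2 * Y - 'X; slice_x3] l.
Definition slice_frozen l : D := nth 0 [:: 1; 1; - (1 + slice_x3)] l.
(** On the plane, the right-hand sides of the three initial exchange relations divided by the
    [slice_mutable], as [slice_exchange] checks. *)
Definition slice_mutated l : D :=
  nth 0 [:: 4 * Y - 3 * 'X; 3 * 'X - 2 * Y; 2 * I * Y - 'X ^+ 2] l.

Definition slice_var (a : 'I_(3 + 3)) : D :=
  match fintype.split a with inl l => slice_mutable l | inr l => slice_frozen l end.

Definition slice_const : K -> D := @polyC _ \o @polyC _.
HB.instance Definition _ := GRing.RMorphism.copy slice_const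
  (@polyC {poly K} \o @polyC K).

Definition slice_mpoly : {mpoly K[3 + 3]} -> E :=
  @tofrac D \o mmap slice_const slice_var.
HB.instance Definition _ := GRing.RMorphism.copy slice_mpoly
  (@tofrac D \o mmap slice_const slice_var).

Definition slice (z : F) : E := evalfrac slice_mpoly z.
Notation slice_local := (frac_local slice_mpoly).

(** Substitutes the curve ['X = c] first and then a value of the inner variable: one nonzero number
    certifies that [d] is not identically zero on that curve. *)
Definition poly2_eval (c : {poly K}) (y : K) (d : D) : K := d.[c].[y].

Lemma slice_tofrac_var a : slice (tofrac 'X_a) = tofrac (slice_var a).
Proof.
apply: etrans (evalfrac_tofrac _ _) _.
by congr tofrac; apply: etrans (mmapX _ _ _) (mmap1U _ _).
Qed.

Lemma slice_local_var a : slice_local (tofrac 'X_a).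
Proof. exact: frac_local_tofrac. Qed.

Lemma slice_localC c : slice_local (ratfunC (3 + 3) c).
Proof. exact: frac_local_tofrac. Qed.

Lemma slice_ratfunC c : slice (ratfunC (3 + 3) c) = tofrac (slice_const c).
Proof.
apply: etrans (evalfrac_tofrac _ _) _.
by congr tofrac; exact: mmapC.
Qed.

Lemma sliceM x y : slice_local x -> slice_local y -> slice (x * y) = slice x * slice y.
Proof. exact: evalfracM. Qed.

Lemma sliceD x y : slice_local x -> slice_local y -> slice (x + y) = slice x + slice y.
Proof. exact: evalfracD. Qed.

Lemma slice_local1 : slice_local 1.
Proof. exact: (frac_local_tofrac _ 1). Qed.

Lemma slice1 : slice 1 = 1.
Proof.
apply: etrans (evalfrac_tofrac _ 1) _; exact: (rmorph1 slice_mpoly).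
Qed.

Lemma slice_localX x n : slice_local x -> slice_local (x ^+ n).
Proof.
move=> hx; elim: n => [|n IH]; first by rewrite expr0; exact: slice_local1.
by rewrite exprS; exact: frac_localM.
Qed.

Lemma sliceX x n : slice_local x -> slice (x ^+ n) = slice x ^+ n.
Proof.
move=> hx; elim: n => [|n IH]; first by rewrite !expr0 slice1.
by rewrite !exprS sliceM ?IH //; exact: slice_localX.
Qed.

Definition slice_at t (g : 'I_(3 + 3) -> D) : Prop :=
  forall a, [/\ g a != 0, slice_local (seed_var t a)
    & slice (seed_var t a) = tofrac (g a)].

(** Denominators are powers of the full product of the variables, so that sums and products only add
    exponents. *)
Lemma slice_laurent t g : slice_at t g ->
  forall z, laurent_ring t z -> slice_local z /\
    exists n G, slice z * tofrac ((\prod_a g a) ^+ n) = tofrac G.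
Proof.
move=> tg z; elim=> {z}.
- move=> z [a [|] ->]; have [ga la ea] := tg a.
    by split=> //; exists 0%N, (g a); rewrite expr0 tofrac1 mulr1.
  have ga' : tofrac (g a) != 0 :> E by rewrite tofrac_eq0.
  have sa : slice (seed_var t a) != 0 by rewrite ea.
  split; first exact: frac_localV.
  exists 1%N, (\prod_(b | b != a) g b).
  rewrite (_ : slice _ = (tofrac (g a))^-1); last first.
    by apply: etrans (evalfracV la sa) _; rewrite -/(slice _) ea.
  have -> : (\prod_b g b) ^+ 1 = g a * \prod_(b | b != a) g b.
    by rewrite expr1; exact: bigD1.
  rewrite tofracM; exact: (mulKf ga').
- split; first exact: slice_local1.
  by exists 0%N, 1; rewrite slice1 expr0 tofrac1 mulr1.
- move=> c x y _ [lx [n [G eG]]] _ [ly [m [H eH]]].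
  have lcx : slice_local (c *: x) by apply: frac_localM => //; exact: slice_localC.
  split; first exact: frac_localD.
  exists (n + m)%N, (slice_const c * G * (\prod_a g a) ^+ m +
                     H * (\prod_a g a) ^+ n).
  rewrite sliceD // [slice (c *: x)]sliceM //; last exact: slice_localC.
  rewrite slice_ratfunC exprD tofracD !tofracM.
  by rewrite (common_denominator _ eG eH).
- move=> x y _ [lx [n [G eG]]] _ [ly [m [H eH]]].
  split; first exact: frac_localM.
  exists (n + m)%N, (G * H).
  by rewrite sliceM // exprD !tofracM mulrACA eG eH.
Qed.



Lemma poly2_eval_monoid c y : monoid_morphism (poly2_eval c y).
Proof. by split=> [|d e]; rewrite /poly2_eval ?hornerC // !hornerM. Qed.

Lemma poly2_eval_zmod c y : zmod_morphism (poly2_eval c y).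
Proof. by move=> d e; rewrite /poly2_eval !hornerE. Qed.

HB.instance Definition _ c y := GRing.isZmodMorphism.Build D K
  (poly2_eval c y) (poly2_eval_zmod c y).
HB.instance Definition _ c y := GRing.isMonoidMorphism.Build D K
  (poly2_eval c y) (poly2_eval_monoid c y).

Definition slice_evalE := (fun c y => (
  (rmorphM (poly2_eval c y) : {morph poly2_eval c y : d e / d * e}),
  (rmorphD (poly2_eval c y) : {morph poly2_eval c y : d e / d + e}),
  (rmorphN (poly2_eval c y) : {morph poly2_eval c y : d / - d}),
  (rmorph1 (poly2_eval c y) : poly2_eval c y 1 = 1),
  (rmorph_nat (poly2_eval c y) : forall n, poly2_eval c y n%:R = n%:R))).

Lemma poly2_evalI c y : poly2_eval c y I = im.
Proof. by rewrite /poly2_eval !hornerC. Qed.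

Lemma poly2_evalY c y : poly2_eval c y Y = y.
Proof. by rewrite /poly2_eval hornerC hornerX. Qed.

Lemma poly2_evalX c y : poly2_eval c y 'X = c.[y].
Proof. by rewrite /poly2_eval hornerX. Qed.

Lemma poly2_eval_x3 c y : poly2_eval c y slice_x3 = 2 * im * (c.[y] - y).
Proof.
rewrite /slice_x3 !(slice_evalE c y).
by rewrite poly2_evalI poly2_evalX poly2_evalY.
Qed.

Lemma poly2_eval_mutable c y l : poly2_eval c y (slice_mutable l) =
  nth 0 [:: c.[y]; 2 * y - c.[y]; 2 * im * (c.[y] - y)] l.
Proof.
case: l => [[|[|[|//]]] ?]; rewrite /slice_mutable /= ?poly2_eval_x3 //
  ?(slice_evalE c y) ?poly2_evalX ?poly2_evalY //.
Qed.

Lemma poly2_eval_frozen c y l : poly2_eval c y (slice_frozen l) =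
  nth 0 [:: 1; 1; - (1 + 2 * im * (c.[y] - y))] l.
Proof.
case: l => [[|[|[|//]]] ?]; rewrite /slice_frozen /slice_x3 /=
  ?(slice_evalE c y) ?poly2_evalI ?poly2_evalX ?poly2_evalY //.
Qed.

Lemma poly2_eval_mutated c y l : poly2_eval c y (slice_mutated l) =
  nth 0 [:: 4 * y - 3 * c.[y]; 3 * c.[y] - 2 * y; 2 * im * y - c.[y] ^+ 2] l.
Proof.
case: l => [[|[|[|//]]] ?]; rewrite /slice_mutated /= ?expr2 ?(slice_evalE c y)
  ?poly2_evalI ?poly2_evalX ?poly2_evalY //.
Qed.

Lemma poly2_eval_neq0 c y d : poly2_eval c y d != 0 -> d != 0.
Proof. by apply: contraNneq => ->; rewrite /poly2_eval !horner0. Qed.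

Lemma slice_var_mutable l : slice_var (lshift 3 l) = slice_mutable l.
Proof. by rewrite /slice_var (unsplitK (inl l : 'I_3 + 'I_3)). Qed.

Lemma slice_var_frozen l : slice_var (rshift 3 l) = slice_frozen l.
Proof. by rewrite /slice_var (unsplitK (inr l : 'I_3 + 'I_3)). Qed.

Let two_neq0 : 2 != 0 :> K. Proof. by rewrite pnatr_eq0. Qed.

Lemma im_lin_neq0 (n m : nat) : (0 < n)%N ->
  n%:R + m%:R * im != 0 /\ n%:R - m%:R * im != 0.
Proof.
move=> n0; apply/andP; rewrite -negb_or -mulf_eq0.
(* The product equals [n^2 + m^2], which is nonzero in characteristic zero. *)
have -> : (n%:R + m%:R * im) * (n%:R - m%:R * im) =
    n%:R * n%:R - m%:R * m%:R * (im * im) by ring.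
rewrite im_sq mulrN1 opprK -!natrM -natrD pnatr_eq0 addn_eq0 muln_eq0.
by case: n n0.
Qed.

Lemma im_neq0 : im != 0.
Proof. by apply: contraTneq (oner_neq0 K) => h; rewrite -oppr_eq0 -im_sq h mul0r eqxx. Qed.

Lemma slice_x3_lin : 1 + 2 * im != 0 /\ 1 - 2 * im != 0.
Proof. exact: (im_lin_neq0 2 (ltn0Sn 0)). Qed.

Lemma poly2_eval_var a : poly2_eval 1 0 (slice_var a) != 0.
Proof.
rewrite -(splitK a); case: (fintype.split a) => l /=.
  rewrite slice_var_mutable poly2_eval_mutable hornerC.
  case: l => [[|[|[|//]]] ?] /=; rewrite ?oner_neq0 ?mulr0 ?sub0r ?oppr_eq0 ?oner_neq0 //.
  by rewrite subr0 mulr1 mulf_neq0 ?im_neq0.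
rewrite slice_var_frozen poly2_eval_frozen hornerC.
case: l => [[|[|[|//]]] ?] /=; rewrite ?oner_neq0 //.
by rewrite oppr_eq0 subr0 mulr1 slice_x3_lin.1.
Qed.

Lemma slice_at_initial : slice_at t0 slice_var.
Proof.
move=> a; split; [exact: poly2_eval_neq0 (poly2_eval_var a)
  | exact: slice_local_var | exact: slice_tofrac_var].
Qed.

Lemma posY_initial i : posY K markov_prin i = frozen K i.
Proof.
have u : uniq [:: idx0; idx1; idx2] by [].
rewrite /posY big_mkcond (big_triple _ u) !mxE /=.
by case: i => [[|[|[|//]]] ?] /=; rewrite ?mul1r ?mulr1 ?expr1;
  congr frozen; apply: val_inj.
Qed.

Lemma negY_initial i : negY K markov_prin i = 1.
Proof.
rewrite /negY big1 // => l; rewrite mxE.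
by case: i => [[|[|[|//]]] ?]; case: l => [[|[|[|//]]] ?].
Qed.

Definition idx_next i : 'I_3 := nth idx0 [:: idx1; idx2; idx0] i.

Lemma markov_initial_from i :
  markov_seed t0 i (idx_next i) (idx_next (idx_next i)).
Proof.
have m := markov_initial K.
case: i => [[|[|[|//]]] h].
- by rewrite (_ : Ordinal h = idx0); [| apply: val_inj].
- by rewrite (_ : Ordinal h = idx1); [exact: markov_seed_rot | apply: val_inj].
- rewrite (_ : Ordinal h = idx2); [|exact: val_inj].
  exact: markov_seed_rot (markov_seed_rot m).
Qed.


Lemma slice_exchange i :
  slice_mutable i * slice_mutated i =
    slice_frozen i * slice_mutable (idx_next i) ^+ 2 +
    slice_mutable (idx_next (idx_next i)) ^+ 2.
Proof.
have e : (I * I + 1) = 0 by rewrite I_sq addNr.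
(* As ring does not know I * I = -1, the multiple of I * I + 1 by which the two
   sides differ is added by hand. *)
case: i => [[|[|[|//]]] ?]; rewrite /slice_mutable /slice_frozen /slice_mutated /slice_x3 /=.
- rewrite -[LHS]addr0 -(mulr0 (4 * ('X - Y) ^+ 2)) -e; ring.
- rewrite -[LHS]addr0 -(mulr0 (4 * ('X - Y) ^+ 2)) -e; ring.
- rewrite -[LHS]addr0 -(mulr0 (-4 * ('X - Y) * Y)) -e; ring.
Qed.

Definition slice_mutation i (a : 'I_(3 + 3)) : D :=
  if a == lshift 3 i then slice_mutated i else slice_var a.

(** The new variable is local since its denominator [x_i] restricts to a nonzero polynomial;
    cancelling that polynomial in the restricted exchange relation identifies the image. *)
Lemma slice_at_mutation i :
  (exists c y, poly2_eval c y (slice_mutated i) != 0) ->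
  slice_at (mutate t0 i) (slice_mutation i).
Proof.
move=> [c [y nz]] a; rewrite /slice_mutation.
have [->|ai] := eqVneq a (lshift 3 i); last first.
  by rewrite mutate_var_neq //; exact: slice_at_initial.
have m := markov_initial_from i; have [o fr _] := m.
have [gi li ei] := slice_at_initial (lshift 3 i).
set j := idx_next i in m o *; set k := idx_next j in m o *.
have lv b : slice_local (seed_var t0 b) by have [] := slice_at_initial b.
have lj2 : slice_local (mutx t0 j ^+ 2) by exact: slice_localX.
have lk2 : slice_local (mutx t0 k ^+ 2) by exact: slice_localX.
have lf : slice_local (frozen K i) by exact: slice_local_var.
have lfj : slice_local (frozen K i * mutx t0 j ^+ 2) by exact: frac_localM.
have gi0 : slice (mutx t0 i) != 0 by rewrite ei tofrac_eq0.
have lm : slice_local (mutx (mutate t0 i) i).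
  rewrite (mutate_var_self o fr) posY_initial negY_initial mul1r.
  by apply: frac_localM; [exact: frac_localD | exact: frac_localV].
split; [exact: poly2_eval_neq0 nz | exact: lm |].
apply: (mulfI gi0); rewrite -sliceM // (markov_exchange m) posY_initial negY_initial.
rewrite mul1r sliceD // sliceM // !sliceX // [slice (frozen K i)]slice_tofrac_var.
rewrite !slice_tofrac_var !slice_var_mutable slice_var_frozen.
by rewrite -!tofracXn -!tofracM -tofracD slice_exchange.
Qed.

Lemma slice_mutated_neq0 i : exists c y, poly2_eval c y (slice_mutated i) != 0.
Proof.
exists 0, 1; rewrite poly2_eval_mutated horner0.
case: i => [[|[|[|//]]] ?] /=.
- by rewrite mulr0 subr0 mulr1 pnatr_eq0.
- by rewrite mulr0 sub0r mulr1 oppr_eq0.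
- by rewrite expr0n subr0 mulr1 mulf_neq0 ?im_neq0.
Qed.

Lemma prod_slice_var : \prod_a slice_var a =
  'X * (2 * Y - 'X) * slice_x3 * - (1 + slice_x3).
Proof.
have u : uniq [:: idx0; idx1; idx2] by [].
rewrite big_split_ord /= !(big_triple _ u) !slice_var_mutable !slice_var_frozen.
by rewrite /slice_mutable /slice_frozen /= !mul1r.
Qed.

(* The root c of the i-th slice coordinate in the outer variable is a root of no
   other factor of the seed mutated at i. *)
Definition slice_root i : {poly K} := nth 0 [:: 0; 2 * 'X; 'X] i.

Lemma slice_root_eval i : (slice_root i).[1] = nth 0 [:: 0; 2; 1] i.
Proof.
case: i => [[|[|[|//]]] ?]; rewrite /slice_root /= ?horner0 ?hornerX //.
by rewrite hornerM hornerX mulr1 -[in LHS]polyC_natr hornerC.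
Qed.

(** On the zero curve of the [i]-th coordinate each factor is a polynomial in the inner variable,
    tested at the value [1]. *)
Lemma slice_root_mutation i a :
  poly2_eval (slice_root i) 1 (slice_mutation i a) != 0.
Proof.
have [n1 n2] := slice_x3_lin.
rewrite /slice_mutation; have [_|] := eqVneq a (lshift 3 i).
  rewrite poly2_eval_mutated slice_root_eval.
  case: i => [[|[|[|//]]] ?] /=.
  - by rewrite mulr0 subr0 mulr1 pnatr_eq0.
  - by rewrite (_ : _ - _ = 4%:R) ?pnatr_eq0 //; ring.
  - by rewrite expr1n mulr1 -oppr_eq0 opprB.
rewrite -(splitK a); case: (fintype.split a) => l /=.
  rewrite eq_lshift slice_var_mutable poly2_eval_mutable slice_root_eval.
  have z2 : 2 * im * -1 != 0 :> K.
    by rewrite !mulf_neq0 ?im_neq0 // oppr_eq0 oner_neq0.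
  case: i => [[|[|[|//]]] ?]; case: l => [[|[|[|//]]] ?] //= _;
    rewrite ?mulr1 ?subr0 ?sub0r ?oner_neq0 ?two_neq0 //.
  - by rewrite (_ : 2 - 1 = 1) ?mulr1 ?mulf_neq0 ?im_neq0 //; ring.
  - by rewrite (_ : 2 - 1 = 1) ?oner_neq0 //; ring.
move=> _; rewrite slice_var_frozen poly2_eval_frozen slice_root_eval.
case: i => [[|[|[|//]]] ?]; case: l => [[|[|[|//]]] ?] //=;
  rewrite ?oner_neq0 // oppr_eq0.
- by rewrite sub0r mulrN1.
- by rewrite (_ : 2 - 1 = 1) ?mulr1 //; ring.
- by rewrite subrr mulr0 addr0 oner_neq0.
Qed.

Lemma slice_upper u : u \in upper_cluster_algebra K markov_prin ->
  slice_local u /\ exists n G,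
    slice u * tofrac ((- (2 * I) * - (1 + slice_x3)) ^+ n) = tofrac G.
Proof.
move=> /asboolP hu.
have ts := seeds_initial K markov_prin.
have [lu [n [G eG]]] := slice_laurent slice_at_initial (hu _ ts).
split=> //; exists n.
have hm i : exists A B, slice u * tofrac A = tofrac B /\ A.[slice_root i] != 0.
  have am := slice_at_mutation (slice_mutated_neq0 i).
  have [_ [m [H eH]]] := slice_laurent am (hu _ (seeds_mutate i ts)).
  exists ((\prod_a slice_mutation i a) ^+ m), H; split=> //.
  suff : poly2_eval (slice_root i) 1 ((\prod_a slice_mutation i a) ^+ m) != 0.
    by apply: contraNneq; rewrite /poly2_eval => ->; rewrite horner0.
  rewrite (rmorphXn (poly2_eval _ _)) expf_neq0 //.
  apply: (big_ind (fun d => poly2_eval (slice_root i) 1 d != 0)) => [|d d'|a _].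
  - by rewrite (rmorph1 (poly2_eval _ _)) oner_neq0.
  - by move=> d0 d0'; rewrite (rmorphM (poly2_eval _ _)) mulf_neq0.
  - exact: slice_root_mutation.
(* The constant [- (2 * I)] collects the leading coefficients [-1] of [2 * Y - 'X] and [2 * I] of
   [slice_x3]. *)
set U := - (2 * I) * - (1 + slice_x3).
have e : \prod_a slice_var a = ('X - (slice_root idx0)%:P) *
    (('X - (slice_root idx1)%:P) * (('X - (slice_root idx2)%:P) * U)).
  rewrite prod_slice_var /slice_root /= subr0 rmorphM /= /U /slice_x3.
  by rewrite (_ : (2 : {poly K})%:P = 2) ?rmorph_nat //; rewrite -/Y; ring.
move: eG; rewrite e !exprMn => eG.
(* The three linear factors are removed one at a time, from the outside inwards. *)
have [A0 [B0 [e0 r0]]] := hm idx0.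
have [G1 eG1] := pole_removal eG e0 r0.
have [A1 [B1 [e1 r1]]] := hm idx1.
have [G2 eG2] := pole_removal eG1 e1 r1.
have [A2 [B2 [e2 r2]]] := hm idx2.
have [G3 eG3] := pole_removal eG2 e2 r2.
by exists G3.
Qed.

End Slice.

(** * The mysterious point and the values of [X] and [W] there *)

Section MysteriousPoint.
Variables (K : numFieldType) (im : K).
Hypothesis im_sq : im * im = -1.

Notation F := (ratfun K (3 + 3)).
Notation D := {poly {poly K}}.
Notation U := (upper_cluster_algebra K markov_prin).
Notation mutx t i := (seed_var t (lshift 3 i)).
Notation t0 := (initial_seed K markov_prin).
Notation slice := (slice im).
Notation slice_local := (frac_local (slice_mpoly im)).
Implicit Types (i j k l : 'I_3).

Let I : D := im%:P%:P.
Let Y : D := 'X%:P.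
Let I_sq : I * I = -1.
Proof. by rewrite -!polyCM im_sq !polyCN. Qed.

Definition origin : {rmorphism D -> K} := poly2_eval 0 0.

Lemma originE d : origin d = poly2_eval 0 0 d. Proof. by []. Qed.

(** Evaluation takes two steps because Laurent expansions may have denominators vanishing at the
    point; by [slice_upper] these cancel on the plane, before the origin is substituted. *)
Definition at_origin (z : F) : K := @evalfrac D K origin (slice z).

Lemma upper_slice_local z : z \in U -> slice_local z.
Proof. by move=> /(slice_upper im_sq)[]. Qed.

(** The denominator left by [slice_upper] takes a power of [2 * im] as value at the origin. *)
Lemma upper_origin_local z : z \in U -> @frac_local D K origin (slice z).
Proof.
move=> /(slice_upper im_sq)[_ [n [G e]]].
set d := (_ ^+ n) in e.
have d0 : origin d != 0.
  have -> : origin d = (origin (- (2 * I) * - (1 + slice_x3 im))) ^+ n.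
    exact: rmorphXn.
  rewrite expf_neq0 // originE /slice_x3 !(slice_evalE (0 : {poly K}) (0 : K)).
  rewrite poly2_evalI poly2_evalX poly2_evalY horner0 subrr mulr0 addr0.
  by rewrite mulrN1 opprK mulf_neq0 ?pnatr_eq0 ?(im_neq0 im_sq).
by exists (origin G / origin d), G, d; rewrite divfK.
Qed.

Lemma at_originM x y : x \in U -> y \in U -> at_origin (x * y) = at_origin x * at_origin y.
Proof.
move=> hx hy; rewrite /at_origin sliceM; [|exact: upper_slice_local..].
by apply: evalfracM; exact: upper_origin_local.
Qed.

Lemma at_originD x y : x \in U -> y \in U -> at_origin (x + y) = at_origin x + at_origin y.
Proof.
move=> hx hy; rewrite /at_origin sliceD; [|exact: upper_slice_local..].
by apply: evalfracD; exact: upper_origin_local.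
Qed.

Lemma at_originZ c x : x \in U -> at_origin (c *: x) = c * at_origin x.
Proof.
move=> hx; rewrite /at_origin.
have -> : slice (c *: x) = tofrac (slice_const c) * slice x.
  rewrite -(slice_ratfunC im); apply: sliceM; last exact: upper_slice_local.
  exact: slice_localC.
rewrite evalfracM; [|exact: frac_local_tofrac|exact: upper_origin_local].
congr (_ * _); apply: etrans (evalfrac_tofrac _ _) _.
exact: (etrans (congr1 (fun q => q.[0]) (hornerC _ _)) (hornerC _ _)).
Qed.

Lemma at_origin1 : at_origin 1 = 1.
Proof.
rewrite /at_origin slice1 -tofrac1; apply: etrans (evalfrac_tofrac _ _) _.
exact: (rmorph1 origin).
Qed.

Lemma at_origin_slice z d : slice z = tofrac d -> at_origin z = poly2_eval 0 0 d.
Proof. by rewrite /at_origin => ->; exact: evalfrac_tofrac. Qed.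

Definition mysterious_fun (u : subalg_sort U) : K^o := at_origin (subalg_val u).

Fact mysterious_scalable : scalable mysterious_fun.
Proof.
by move=> c u; rewrite /mysterious_fun subalg_valZ at_originZ //; exact: valP.
Qed.

Fact mysterious_zmod : zmod_morphism mysterious_fun.
Proof.
move=> u v; have hN : mysterious_fun (- v) = - mysterious_fun v.
  by rewrite -scaleN1r mysterious_scalable; exact: scaleN1r.
rewrite -hN /mysterious_fun subalg_valD; apply: at_originD; exact: valP.
Qed.

Fact mysterious_monoid : monoid_morphism mysterious_fun.
Proof.
split=> [|u v]; rewrite /mysterious_fun; first by rewrite subalg_val1 at_origin1.
by rewrite subalg_valM; apply: at_originM; exact: valP.
Qed.

HB.instance Definition _ := GRing.isZmodMorphism.Build (subalg_sort U) K^o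
  mysterious_fun mysterious_zmod.
HB.instance Definition _ := GRing.isMonoidMorphism.Build (subalg_sort U) K^o
  mysterious_fun mysterious_monoid.
HB.instance Definition _ := GRing.isScalable.Build K (subalg_sort U) K^o *:%R
  mysterious_fun mysterious_scalable.

Definition mysterious_point : spec_points U := mysterious_fun.

Lemma mysterious_eval z : z \in U -> point_eval mysterious_point z = at_origin z.
Proof. by move=> hz; rewrite -[in RHS](subalg_insubdK hz). Qed.

Lemma mysterious_mutable l : point_eval mysterious_point (mutx t0 l) = 0.
Proof.
rewrite mysterious_eval; last exact: upper_seed_var (seeds_initial _ _).
rewrite (at_origin_slice (slice_tofrac_var im _)) slice_var_mutable.
rewrite poly2_eval_mutable horner0.
by case: l => [[|[|[|//]]] ?]; rewrite /= ?subrr ?mulr0 ?subr0.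
Qed.

Lemma mysterious_deep : deep_locus markov_prin U mysterious_point.
Proof.
apply: all_zero_deep mysterious_mutable.
- exact: upper_seed_var.
- exact: upper_frozenV.
Qed.

Definition upper_X i : F :=
  markov_X (frozen K (idx_next i)) (frozen K (idx_next (idx_next i)))
    (mutx t0 i) (mutx t0 (idx_next i)) (mutx t0 (idx_next (idx_next i))).

Definition upper_W : F :=
  markov_W (frozen K idx0) (frozen K idx1) (frozen K idx2)
    (mutx t0 idx0) (mutx t0 idx1) (mutx t0 idx2).

Lemma coefY_initial i : coefY K markov_prin i = frozen K i.
Proof. by rewrite /coefY posY_initial negY_initial invr1 mulr1. Qed.

Lemma upper_X_in i : upper_X i \in U.
Proof.
have := upper_has_gens K; rewrite /has_gens !coefY_initial.
move=> [[_ h0 _] [_ h1 _] [_ h2 _]].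
by case: i => [[|[|[|//]]] h]; rewrite /upper_X /idx_next /=;
   [rewrite (_ : Ordinal h = idx0) | rewrite (_ : Ordinal h = idx1)
   | rewrite (_ : Ordinal h = idx2)] => //; apply: val_inj.
Qed.

Lemma upper_W_in : upper_W \in U.
Proof.
by have := upper_has_gens K; rewrite /has_gens !coefY_initial => -[[_ _ ?] _ _].
Qed.

Lemma upper_XE i : let j := idx_next i in let k := idx_next j in
  mutx t0 j * mutx t0 k * upper_X i =
    frozen K k * mutx t0 i ^+ 2 + frozen K j * frozen K k * mutx t0 k ^+ 2 +
    mutx t0 j ^+ 2.
Proof.
move=> j k; rewrite /upper_X /markov_X mulrC divfK // mulf_neq0 //;
exact: seed_var_neq0 (seeds_initial _ _).
Qed.

Lemma upper_WE : mutx t0 idx0 * upper_W =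
  (1 - frozen K idx0 * frozen K idx1 * frozen K idx2) ^+ 2 +
    frozen K idx0 * upper_X idx0 ^+ 2.
Proof.
rewrite /upper_W /markov_W mulrC divfK //.
exact: seed_var_neq0 (seeds_initial _ _).
Qed.

Lemma upper_mutx l : mutx t0 l \in U.
Proof. exact: upper_seed_var (seeds_initial _ _). Qed.

Lemma upper_opp x : x \in U -> - x \in U.
Proof. by move=> hx; rewrite -scaleN1r; exact: rpredZ. Qed.

Lemma slice_upperM x y : x \in U -> y \in U -> slice (x * y) = slice x * slice y.
Proof. by move=> hx hy; apply: sliceM; exact: upper_slice_local. Qed.

Lemma slice_upperD x y : x \in U -> y \in U -> slice (x + y) = slice x + slice y.
Proof. by move=> hx hy; apply: sliceD; exact: upper_slice_local. Qed.

Lemma slice_upperX x n : x \in U -> slice (x ^+ n) = slice x ^+ n.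
Proof. by move=> hx; apply: sliceX; exact: upper_slice_local. Qed.

Lemma slice_upperN x : x \in U -> slice (- x) = - slice x.
Proof.
move=> hx; apply/eqP; rewrite -addr_eq0 -slice_upperD ?upper_opp // addNr -tofrac0.
apply/eqP; apply: etrans (evalfrac_tofrac _ 0) _; exact: rmorph0.
Qed.

Lemma slice_mutx l : slice (mutx t0 l) = tofrac (slice_mutable im l).
Proof. by rewrite -slice_var_mutable; exact: slice_tofrac_var. Qed.

Lemma slice_frozenE l : slice (frozen K l) = tofrac (slice_frozen im l).
Proof. by rewrite -slice_var_frozen; exact: slice_tofrac_var. Qed.

Let I_sq1 : I * I + 1 = 0. Proof. by rewrite I_sq addNr. Qed.

(** Restrictions of the [upper_X] to the plane, with values [2 im], [2 im] and [2] at the origin. *)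
Definition slice_X i : D := nth 0 [:: 2 * I - 3 * 'X + 2 * Y; 2 * I - 'X; 2] i.

Lemma slice_XE i : let j := idx_next i in let k := idx_next j in
  slice_mutable im j * slice_mutable im k * slice_X i =
    slice_frozen im k * slice_mutable im i ^+ 2 +
    slice_frozen im j * slice_frozen im k * slice_mutable im k ^+ 2 +
    slice_mutable im j ^+ 2.
Proof.
case: i => [[|[|[|//]]] ?]; rewrite /slice_mutable /slice_frozen /slice_X /slice_x3 /=.
(* The term added in each case is the multiple of [I * I + 1] by which the two sides differ as
   polynomials in [I]. *)
- rewrite -[LHS]addr0 -(mulr0 (- (4 * (2 * Y - 'X) * ('X - Y) +
    4 * ('X - Y) ^+ 2 * (1 + 2 * I * ('X - Y))))) -I_sq1; ring.
- rewrite -[LHS]addr0 -(mulr0 (- (4 * (('X - Y) * 'X - ('X - Y) ^+ 2)))) -I_sq1; ring.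
- rewrite -[LHS]addr0 -(mulr0 (4 * ('X - Y) ^+ 2)) -I_sq1; ring.
Qed.

Lemma slice_upper_X i : slice (upper_X i) = tofrac (slice_X i).
Proof.
have := congr1 slice (upper_XE i); set j := idx_next i; set k := idx_next j.
have hX := upper_X_in i; have h l := upper_mutx l; have hf l := upper_frozen K l.
have h2 l : mutx t0 l ^+ 2 \in U by exact: rpredX.
have hjk : mutx t0 j * mutx t0 k \in U by exact: rpredM.
have hffk : frozen K j * frozen K k \in U by exact: rpredM.
have a1 : frozen K k * mutx t0 i ^+ 2 \in U by exact: rpredM.
have a2 : frozen K j * frozen K k * mutx t0 k ^+ 2 \in U by exact: rpredM.
have a12 := rpredD a1 a2.
rewrite (slice_upperM hjk hX) (slice_upperM (h j) (h k)) (slice_upperD a12 (h2 j)).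
rewrite (slice_upperD a1 a2) (slice_upperM (hf k) (h2 i)) (slice_upperM hffk (h2 k)).
rewrite (slice_upperM (hf j) (hf k)) !slice_upperX // !slice_mutx !slice_frozenE => e.
have nz l : tofrac (slice_mutable im l) != 0 :> {fraction D}.
  rewrite tofrac_eq0 -slice_var_mutable.
  exact: poly2_eval_neq0 (poly2_eval_var im_sq (lshift 3 l)).
apply: (mulfI (mulf_neq0 (nz j) (nz k))); rewrite e.
by rewrite -!tofracXn -!tofracM -!tofracD slice_XE.
Qed.

(** Restriction of [upper_W] to the plane, with value [-4 im] at the origin. *)
Definition slice_W : D := - (4 * I) + 5 * 'X - 4 * Y.

Lemma slice_WE : slice_mutable im idx0 * slice_W =
  (1 - slice_frozen im idx0 * slice_frozen im idx1 * slice_frozen im idx2) ^+ 2 +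
    slice_frozen im idx0 * slice_X idx0 ^+ 2.
Proof.
rewrite /slice_mutable /slice_frozen /slice_X /slice_x3 /slice_W /=.
rewrite -[LHS]addr0 -(mulr0 (4 + 4 * ('X - Y) ^+ 2)) -I_sq1; ring.
Qed.

Lemma slice_upper_W : slice upper_W = tofrac slice_W.
Proof.
have := congr1 slice upper_WE.
have hX := upper_X_in idx0; have hW := upper_W_in; have h := upper_mutx idx0.
have hf l := upper_frozen K l.
have h01 := rpredM (hf idx0) (hf idx1); have h012 := rpredM h01 (hf idx2).
have h1 : 1 \in U by exact: rpred1.
have hN := upper_opp h012; have hd := rpredD h1 hN.
have hX2 : upper_X idx0 ^+ 2 \in U by exact: rpredX.
have hd2 := rpredX 2 hd; have hfX := rpredM (hf idx0) hX2.
rewrite (slice_upperM h hW) (slice_upperD hd2 hfX) (slice_upperM (hf idx0) hX2).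
rewrite (slice_upperX 2 hd) (slice_upperX 2 hX) (slice_upperD h1 hN).
rewrite (slice_upperN h012) (slice_upperM h01 (hf idx2)) (slice_upperM (hf _) (hf _)).
rewrite slice1 slice_upper_X slice_mutx !slice_frozenE => e.
have nz : tofrac (slice_mutable im idx0) != 0 :> {fraction D}.
  rewrite tofrac_eq0 -slice_var_mutable.
  exact: poly2_eval_neq0 (poly2_eval_var im_sq (lshift 3 idx0)).
apply: (mulfI nz); rewrite e -tofrac1.
by rewrite -!(tofracXn, tofracM, tofracB, tofracD) slice_WE.
Qed.

Lemma mysterious_X i : point_eval mysterious_point (upper_X i) != 0.
Proof.
rewrite (mysterious_eval (upper_X_in i)) (at_origin_slice (slice_upper_X i)).
have n2 : 2 * im != 0 by rewrite mulf_neq0 ?pnatr_eq0 ?(im_neq0 im_sq).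
case: i => [[|[|[|//]]] ?]; rewrite /slice_X /= ?(slice_evalE (0 : {poly K}) (0 : K))
  ?poly2_evalI ?poly2_evalX ?poly2_evalY ?horner0 ?mulr0 ?subr0 ?addr0 //.
by rewrite pnatr_eq0.
Qed.

Lemma mysterious_W : point_eval mysterious_point upper_W != 0.
Proof.
rewrite (mysterious_eval upper_W_in) (at_origin_slice slice_upper_W) /slice_W.
rewrite !(slice_evalE (0 : {poly K}) (0 : K)).
rewrite poly2_evalI poly2_evalX poly2_evalY horner0 !mulr0 addr0 subr0 oppr_eq0.
by rewrite mulf_neq0 ?pnatr_eq0 ?(im_neq0 im_sq).
Qed.

Lemma mysterious_frozen l : point_eval mysterious_point (frozen K l) != 0.
Proof. by apply: point_frozen_neq0; [exact: upper_seed_var | exact: upper_frozenV]. Qed.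

End MysteriousPoint.

(** * Triviality of the stabilizer of the mysterious point *)

Section MysteriousNotStabilized.
Variables (K : numFieldType) (im : K).
Hypothesis im_sq : im * im = -1.

Notation F := (ratfun K (3 + 3)).
Notation A := (subalg_sort (cluster_algebra K markov_prin)).
Notation U := (upper_cluster_algebra K markov_prin).
Notation mutx t i := (seed_var t (lshift 3 i)).
Notation t0 := (initial_seed K markov_prin).
Implicit Types (i j k l : 'I_3).

(** Two specialisations separate the monomials: all variables [1] except [x_k = 0], then all [1]
    except [y_i = 0]. *)
Lemma exchange_monomials_free i j k (a b : K) : j != k ->
  a *: (frozen K i * mutx t0 j ^+ 2) + b *: mutx t0 k ^+ 2 = 0 -> a = 0 /\ b = 0.
Proof.
move=> jk e.
pose q : {mpoly K[3 + 3]} := a%:MP * ('X_(rshift 3 i) * 'X_(lshift 3 j) ^+ 2) +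
  b%:MP * 'X_(lshift 3 k) ^+ 2.
have q0 : q = 0.
  apply/eqP; rewrite -tofrac_eq0 tofracD (tofracM a%:MP) (tofracM b%:MP).
  by rewrite (tofracM 'X_(rshift 3 i)) !tofracXn; apply/eqP.
have ev (v : 'I_(3 + 3) -> K) : a * (v (rshift 3 i) * v (lshift 3 j) ^+ 2) +
    b * v (lshift 3 k) ^+ 2 = 0.
  have := congr1 (meval v) q0.
  by rewrite /q meval0 mevalD !mevalM !mevalC !mevalXU.
split.
- have := ev (fun c => (c != lshift 3 k)%:R).
  rewrite eq_rlshift eq_lshift jk eqxx /= expr0n mulr0 addr0 expr1n !mulr1.
  exact.
- have := ev (fun c => (c != rshift 3 i)%:R).
  rewrite !eq_lrshift eqxx /= mul0r mulr0 add0r expr1n mulr1.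
  exact.
Qed.

Section Eigen.
Variable psi : {lrmorphism subalg_sort U -> subalg_sort U}.

(** [c] is the weight of [z] under [psi]; weights are taken in [U], where [X] and [W] live. *)
Definition eigen (c : K) (z : F) : Prop :=
  exists2 u : subalg_sort U, subalg_val u = z & psi u = c *: u.

Let psiM u v : psi (u * v) = psi u * psi v. Proof. exact: rmorphM. Qed.
Let psiD u v : psi (u + v) = psi u + psi v. Proof. exact: rmorphD. Qed.
Let psiZ c u : psi (c *: u) = c *: psi u. Proof. exact: linearZ_LR. Qed.

Lemma eigenM c d x y : eigen c x -> eigen d y -> eigen (c * d) (x * y).
Proof.
move=> [u <- hu] [v <- hv]; exists (u * v); first by rewrite subalg_valM.
by rewrite psiM hu hv -scalerAl -scalerAr scalerA.
Qed.

Lemma eigenD c x y : eigen c x -> eigen c y -> eigen c (x + y).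
Proof.
move=> [u <- hu] [v <- hv]; exists (u + v); first by rewrite subalg_valD.
by rewrite psiD hu hv scalerDr.
Qed.

Lemma eigenX c x n : eigen c x -> eigen (c ^+ n) (x ^+ n).
Proof.
move=> h; elim: n => [|n IH]; last by rewrite !exprS; exact: eigenM.
rewrite !expr0; exists 1; first exact: subalg_val1.
by rewrite scale1r; exact: rmorph1.
Qed.

Lemma eigenN c x : eigen c x -> eigen c (- x).
Proof.
move=> [u <- hu]; exists ((-1) *: u); first by rewrite subalg_valZ scaleN1r.
by rewrite psiZ hu !scalerA mulrC.
Qed.

Lemma eigen_val c x : eigen c x -> subalg_val (psi (insubd 0 x)) = c *: x.
Proof.
move=> [u <- hu]; rewrite -subalg_valZ -hu; congr (subalg_val (psi _)).
exact: valKd.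
Qed.

(** Cancel [x] and [c] in the multiplicativity of [psi]. Membership of [y] in [U] is assumed because
    a quotient of elements of [U] may leave [U]. *)
Lemma eigen_factor c d x y : x != 0 -> c != 0 -> y \in U ->
  eigen c x -> eigen (c * d) (x * y) -> eigen d y.
Proof.
move=> x0 c0 hy [u ux hu] [v vxy hv]; exists (SubalgElt hy) => //.
have uv : u * SubalgElt hy = v by apply: subalg_val_inj; rewrite subalg_valM ux vxy.
have e := psiM u (SubalgElt hy); rewrite uv hv hu in e.
apply: subalg_val_inj; apply: (mulfI x0).
rewrite subalg_valZ -ux -subalg_valM.
have := congr1 (@subalg_val _ _ _) e.
rewrite -scalerAl !subalg_valZ -scalerA => /eqP.
rewrite -subr_eq0 -scalerBr scaler_eq0 (negbTE c0) /= subr_eq0 => /eqP <-.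
by rewrite -[RHS]scalerAr; congr (_ *: _); rewrite vxy ux.
Qed.

Lemma eigen_fixed (p : spec_points U) c z : (forall u, p (psi u) = p u) ->
  eigen c z -> point_eval p z != 0 -> c = 1.
Proof.
move=> st [u <- hu]; rewrite point_eval_val => pu; apply: (mulIf pu).
rewrite mul1r -[RHS]st hu; exact/esym/linearZ_LR.
Qed.

Lemma eigen_restrict (phi : {lrmorphism A -> A}) c z (hz : z \in cluster_algebra K markov_prin) :
  extends_aut phi psi -> z \in U -> phi (SubalgElt hz) = c *: SubalgElt hz -> eigen c z.
Proof.
move=> ext hu e; exists (SubalgElt hu) => //; apply: subalg_val_inj.
rewrite subalg_valZ; apply: etrans (esym (ext (SubalgElt hz) (SubalgElt hu) erefl)) _.
by rewrite e; exact: subalg_valZ.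
Qed.

End Eigen.

Lemma mysterious_not_stabilized :
  ~ stabilized_locus markov_prin U (mysterious_point im_sq).
Proof.
move=> [phi [[_ sc] [a0 nfix] [psi ext st]]].
have ts := seeds_initial K markov_prin.
have fix1 c z : eigen psi c z -> point_eval (mysterious_point im_sq) z != 0 -> c = 1.
  exact: eigen_fixed.
(* Each variable has a weight; the last clause leads back from weight [1] to an element fixed by
   [phi]. *)
have ev t a : seeds K markov_prin t -> exists2 c, c != 0 &
    eigen psi c (seed_var t a) /\
    (c = 1 -> forall b : A, subalg_val b = seed_var t a -> phi b = b).
  move=> tt; have hA := cluster_seed_var a tt.
  have [c c0 e] := sc t a (SubalgElt hA) tt erefl.
  exists c => //; split; first exact: eigen_restrict ext (upper_seed_var a tt) e.
  move=> c1 b eb; have -> : b = SubalgElt hA by apply: subalg_val_inj.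
  by rewrite e c1 scale1r.
have fr l : eigen psi 1 (frozen K l).
  have [c _ [h _]] := ev _ (rshift 3 l) ts.
  by rewrite -(fix1 c _ h (mysterious_frozen im_sq l)).
have [c0 c0n [e0 f0]] := ev _ (lshift 3 idx0) ts.
have [c1 c1n [e1 f1]] := ev _ (lshift 3 idx1) ts.
have [c2 c2n [e2 f2]] := ev _ (lshift 3 idx2) ts.
have sq i cj ck : eigen psi cj (mutx t0 (idx_next i)) ->
    eigen psi ck (mutx t0 (idx_next (idx_next i))) -> cj ^+ 2 = ck ^+ 2.
  set j := idx_next i; set k := idx_next j => ej ek.
  have m := markov_initial_from K i; have [_ _ njk] := markov_neq m.
  have [ci _ [ei _]] := ev _ (lshift 3 i) ts.
  have [d _ [ed _]] := ev _ (lshift 3 i) (seeds_mutate i ts).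
  have := eigenM ei ed; rewrite (markov_exchange m) posY_initial negY_initial mul1r.
  move=> h; have /eigen_val := h.
  have hj := eigenM (fr i) (eigenX 2 ej); have hk := eigenX 2 ek.
  have hj' := eigen_val hj; have hk' := eigen_val hk.
  rewrite mul1r in hj' hj.
  (* Both monomials lie in [U], so the default [0] of [insubd] does not occur and [insubd] is
     additive here. *)
  have -> : insubd (0 : subalg_sort U) (frozen K i * mutx t0 j ^+ 2 + mutx t0 k ^+ 2) =
      insubd 0 (frozen K i * mutx t0 j ^+ 2) + insubd 0 (mutx t0 k ^+ 2).
    have [u uj _] := hj; have [v vk _] := hk; have [w wjk _] := h.
    have hjU : frozen K i * mutx t0 j ^+ 2 \in U by rewrite -uj; exact: valP.
    have hkU : mutx t0 k ^+ 2 \in U by rewrite -vk; exact: valP.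
    by apply: subalg_val_inj; rewrite subalg_valD !subalg_insubdK // rpredD.
  rewrite (rmorphD psi) subalg_valD hj' hk' scalerDr => /eqP.
  rewrite -subr_eq0 opprD addrACA -!scalerBl => /eqP.
  move=> /(exchange_monomials_free njk)[/eqP + /eqP].
  by rewrite !subr_eq0 => /eqP -> /eqP ->.
have s12 : c1 ^+ 2 = c2 ^+ 2 by exact: sq idx0 _ _ e1 e2.
have s20 : c2 ^+ 2 = c0 ^+ 2 by exact: sq idx1 _ _ e2 e0.
(* Once the squared weights agree, the numerator of [X] has weight [cj ^+ 2], so [X] has weight
   [cj / ck]. As [X] does not vanish at the fixed point, this weight is [1]. *)
have hX i ci cj ck : eigen psi ci (mutx t0 i) ->
    eigen psi cj (mutx t0 (idx_next i)) ->
    eigen psi ck (mutx t0 (idx_next (idx_next i))) ->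
    ci ^+ 2 = cj ^+ 2 -> ck ^+ 2 = cj ^+ 2 -> cj != 0 -> ck != 0 ->
    cj = ck /\ eigen psi 1 (upper_X K i).
  set j := idx_next i; set k := idx_next j => ei ej ek ij kj cj0 ck0.
  have num : eigen psi (cj ^+ 2) (mutx t0 j * mutx t0 k * upper_X K i).
    rewrite upper_XE; apply: eigenD; last exact: eigenX.
    apply: eigenD.
      by rewrite -[cj ^+ 2]mul1r -ij; apply: eigenM => //; exact: eigenX.
    rewrite -[cj ^+ 2]mul1r -[X in X * _](mulr1 1) -kj.
    by apply: eigenM; [exact: eigenM | exact: eigenX].
  have cjk : cj * ck != 0 by rewrite mulf_neq0.
  have X : eigen psi (cj ^+ 2 / (cj * ck)) (upper_X K i).
    apply: (@eigen_factor psi (cj * ck) _ (mutx t0 j * mutx t0 k)) => //.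
    - by rewrite mulf_neq0 // seed_var_neq0.
    - exact: upper_X_in.
    - exact: eigenM.
    - by rewrite mulrC divfK.
  have g := fix1 _ _ X (mysterious_X im_sq i); split; last by rewrite -g.
  apply: (mulfI cj0); rewrite -expr2 -[LHS](divfK cjk) g mul1r; reflexivity.
have [c12 X0] := hX idx0 _ _ _ e0 e1 e2 (etrans (esym s20) (esym s12)) (esym s12) c1n c2n.
have [c20 _] := hX idx1 _ _ _ e1 e2 e0 s12 (esym s20) c2n c0n.
(* The numerator of [W] is built from frozen variables and [X], all of weight [1]. Nonvanishing of
   [W] then makes the common weight of the mutable variables trivial. *)
have W : eigen psi c0^-1 (upper_W K).
  apply: (@eigen_factor psi c0 _ (mutx t0 idx0)) => //.
  - exact: seed_var_neq0.
  - exact: upper_W_in.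
  - have o : eigen psi 1 1.
      by exists 1; [exact: subalg_val1 | rewrite scale1r; exact: rmorph1].
    have h := eigenM (eigenM (fr idx0) (fr idx1)) (fr idx2).
    rewrite !mulr1 in h; have hl := eigenX 2 (eigenD o (eigenN h)).
    have hYX := eigenM (fr idx0) (eigenX 2 X0).
    rewrite expr1n mulr1 in hYX; rewrite expr1n in hl.
    rewrite upper_WE mulfV //; exact: eigenD.
have c01 : c0 = 1 by rewrite -[c0]invrK (fix1 _ _ W (mysterious_W im_sq)) invr1.
apply/negP: nfix; rewrite negbK; apply/eqP.
apply: (fixed_seed_id ts) => a; exists (SubalgElt (cluster_seed_var a ts)) => //.
suff h b : subalg_val b = seed_var t0 a -> phi b = b by exact: h.
rewrite -(splitK a); case: (fintype.split a) => l /= vb.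
  have [el|el|el] := @mem_triple idx0 idx1 idx2 l isT; rewrite el in vb.
  - exact: f0 c01 b vb.
  - by apply: (f1 _ b vb); rewrite c12 c20.
  - by apply: (f2 _ b vb); rewrite c20.
have [c _ [h f]] := ev _ (rshift 3 l) ts.
exact: f (fix1 c _ h (mysterious_frozen im_sq l)) b vb.
Qed.

End MysteriousNotStabilized.

Theorem proposition3p22 (R : realType) :
  deep_locus markov_prin (cluster_algebra R[i] markov_prin)
    = stabilized_locus markov_prin (cluster_algebra R[i] markov_prin) /\
  stabilized_locus markov_prin (upper_cluster_algebra R[i] markov_prin)
    `<` deep_locus markov_prin (upper_cluster_algebra R[i] markov_prin).
Proof.
have im_sq : 'i * 'i = -1 :> R[i] by rewrite -expr2 sqrCi.
split; first by apply/seteqP; split; [exact: deep_sub_stabilized | exact: stabilized_sub_deep].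
split; first exact: stabilized_sub_deep.
move=> /(_ _ (@mysterious_deep _ _ im_sq)); exact: mysterious_not_stabilized.
Qed.
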